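(* There exists a constant $C^*>0$ depending only on $N$ such that the following holds. Let $T>0$ and let $\theta(t,x)$ be a function in $L^\infty(0,T;L^2(\mathbb{R}^N))\cap L^2(0,T;H^{1/2}(\mathbb{R}^N))$ with initial value $\theta_0=\theta(0,\cdot)\in L^2(\mathbb{R}^N)$. For $\lambda>0$ put $\theta_\lambda=(\theta-\lambda)_+$. Suppose that for every $\lambda>0$ the level set energy inequality $$\int_{\mathbb{R}^N}\theta_\lambda^2(t_2,x)\,dx+2\int_{t_1}^{t_2}\int_{\mathbb{R}^N}|\Lambda^{1/2}\theta_\lambda|^2\,dx\,dt\le\int_{\mathbb{R}^N}\theta_\lambda^2(t_1,x)\,dx,\qquad 0\le t_1<t_2\le T,$$ holds, and that the same inequalities hold with $\theta$ replaced by $-\theta$ (that is, with $\theta_\lambda$ replaced by $(-\theta-\lambda)_+$). Then $$\sup_{x\in\mathbb{R}^N}|\theta(T,x)|\le C^*\,\frac{\|\theta_0\|_{L^2(\mathbb{R}^N)}}{T^{N/2}}.$$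
   Context: $N\ge1$ is the space dimension. $\Lambda=(-\Delta)^{1/2}$ acts in the $x$ variable, and $\Lambda^{1/2}=(-\Delta)^{1/4}$. $(y)_+=\max(y,0)$. The supremum is an essential supremum. *)

(* Defs.v *)
From HB Require Import structures.
From mathcomp Require Import all_boot all_order all_algebra.
From mathcomp Require Import all_classical all_reals all_analysis.
From mathcomp.real_closed Require Import complex.

Set Implicit Arguments.
Unset Strict Implicit.
Unset Printing Implicit Defensive.

Import Order.TTheory GRing.Theory Num.Theory.
Import numFieldNormedType.Exports.

Local Open Scope classical_set_scope.
Local Open Scope ring_scope.

Section LebesgueRn.
Context {R : realType}.

(* R^n is n.-tuple R with its product sigma-algebra. *)
Definition consR n (p : R * n.-tuple R) : n.+1.-tuple R := [tuple of p.1 :: p.2].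

Lemma measurable_consR n : measurable_fun setT (@consR n).
Proof. exact: (measurable_cons measurable_fst measurable_snd). Qed.

Section step.
Variables (n : nat) (m : {sigma_finite_measure set (n.-tuple R) -> \bar R}).

Definition lebesgue_step : set (n.+1.-tuple R) -> \bar R :=
  pushforward (@lebesgue_measure R \x m)%E (@consR n).

Let step0 : lebesgue_step set0 = 0%E.
Proof. by rewrite /lebesgue_step /pushforward preimage_set0 measure0. Qed.

Let step_ge0 A : (0 <= lebesgue_step A)%E.
Proof. by rewrite /lebesgue_step /pushforward measure_ge0. Qed.

Let step_sigma_additive : semi_sigma_additive lebesgue_step.
Proof.
move=> F mF tF mUF; rewrite /lebesgue_step /pushforward preimage_bigcup.
apply: measure_semi_sigma_additive.
- by move=> k; rewrite -[X in measurable X]setTI; exact: measurable_consR.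
- apply/trivIsetP => /= i j _ _ ij; rewrite -preimage_setI.
  by move/trivIsetP : tF => /(_ _ _ _ _ ij) ->//; rewrite preimage_set0.
- rewrite -preimage_bigcup -[X in measurable X]setTI.
  exact: measurable_consR.
Qed.

HB.instance Definition _ := isMeasure.Build _ _ _ lebesgue_step
  step0 step_ge0 step_sigma_additive.

Lemma lebesgue_stepE (A : set R) (B : set (n.-tuple R)) :
  measurable A -> measurable B ->
  lebesgue_step [set x | A (thead x) /\ B [tuple of behead x]] =
  (lebesgue_measure A * m B)%E.
Proof.
move=> mA mB; rewrite -product_measure1E// /lebesgue_step /pushforward.
congr (_ _); apply/seteqP; split=> -[a b] /=.
  rewrite theadE; case=> ? Bb; split=> //.
  by rewrite (_ : b = [tuple of behead (consR (a, b))])//; exact/val_inj.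
case=> ? Bb; split; first by rewrite theadE.
by rewrite (_ : [tuple of _] = b)//; exact/val_inj.
Qed.

Let step_sigma_finite : sigma_finite setT lebesgue_step.
Proof.
have /sigma_finiteP[F [TF ndF Foo]] := sigma_finiteT (@lebesgue_measure R).
have /sigma_finiteP[G [TG ndG Goo]] := sigma_finiteT m.
exists (fun k => [set x | F k (thead x) /\ G k [tuple of behead x]]).
  apply/seteqP; split=> x //= _.
  have : (\bigcup_k F k) (thead x) by rewrite -TF.
  have : (\bigcup_k G k) [tuple of behead x] by rewrite -TG.
  move=> [k _ Gk] [l _ Fl]; exists (maxn k l) => //; split.
    by move: Fl; exact/subsetPset/ndF/leq_maxr.
  by move: Gk; exact/subsetPset/ndG/leq_maxl.
move=> k; have [mF Fk] := Foo k; have [mG Gk] := Goo k; split.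
  apply: measurableI; rewrite -[X in measurable X]setTI.
    exact: (measurable_tnth ord0).
  exact: measurable_behead.
by rewrite lebesgue_stepE// lte_mul_pinfty// ge0_fin_numE.
Qed.

HB.instance Definition _ := Measure_isSigmaFinite.Build _ _ _ lebesgue_step
  step_sigma_finite.

End step.

(* The n-fold product of lebesgue_measure, transported along R * R^n -> R^n.+1;
   lebesgue_Rn_box below gives its (characterizing) values on boxes. *)
Fixpoint lebesgue_Rn n : {sigma_finite_measure set (n.-tuple R) -> \bar R} :=
  match n with
  | 0 => dirac [tuple]
  | n'.+1 => lebesgue_step (lebesgue_Rn n')
  end.

Lemma measurable_box n (A : 'I_n -> set R) : (forall i, measurable (A i)) ->
  measurable [set x : n.-tuple R | forall i, A i (tnth x i)].
Proof.
move=> mA.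
rewrite (_ : [set _ | _] = \bigcap_(i in [set: 'I_n]) ((@tnth n R)^~ i @^-1` A i)).
  apply: fin_bigcap_measurable => [|i _]; first exact: finite_finset.
  by rewrite -[X in measurable X]setTI; apply: (@measurable_tnth _ R n i) => //; exact: mA.
by apply/seteqP; split=> x /= xA i; [move=> _|]; exact: xA.
Qed.

Lemma lebesgue_Rn_box n (A : 'I_n -> set R) : (forall i, measurable (A i)) ->
  lebesgue_Rn n [set x | forall i, A i (tnth x i)] =
  (\prod_(i < n) lebesgue_measure (A i))%E.
Proof.
elim: n A => [|n IH] A mA.
  rewrite big_ord0 /= diracE mem_set//= => -[]//.
pose B i := A (lift ord0 i); have mB i : measurable (B i) by exact: mA.
rewrite big_ord_recl -(IH B)// -lebesgue_stepE//; last exact: measurable_box.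
congr (lebesgue_step _ _); apply/seteqP; split=> x /=.
  by move=> xA; split=> [|i]; [exact: xA|have := xA (lift ord0 i);
    rewrite [x in tnth x _]tuple_eta tnthS].
move=> [x0 xA] i; case: (unliftP ord0 i) => [j|] ->//.
by rewrite [x in tnth x _]tuple_eta tnthS; exact: xA.
Qed.

End LebesgueRn.

Section Spaces.
Context {R : realType} {N : nat}.
Local Notation V := (N.-tuple R).
Local Notation mu := (@lebesgue_Rn R N).
Implicit Types (f g : V -> R) (F : V -> R[i]) (x xi : V).

Definition dotRn (x y : V) : R := \sum_(i < N) tnth x i * tnth y i.
Definition enorm (x : V) : R := Num.sqrt (dotRn x x).

Definition L2 : set (V -> R) := [set f | f \in Lfun mu 2%:E].
Definition L2norm f : \bar R := 'N[mu]_2%:E[EFin \o f].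

(* \int f(x) e^{- i x.xi} dx for real f; meaningful for integrable f. *)
Definition fourier f xi : R[i] :=
  Complex (\int[mu]_x (f x * cos (dotRn x xi)))
          (- \int[mu]_x (f x * sin (dotRn x xi))).

(* F is the Fourier-Plancherel transform of f in L^2: the L^2-limit of the
   transforms of the (integrable) truncations of f to balls. *)
Definition is_fourierL2 f F : Prop :=
  [/\ measurable_fun setT (fun xi => complex.Re (F xi)),
      measurable_fun setT (fun xi => complex.Im (F xi)) &
      (fun n : nat => \int[mu]_xi
         (Normc.normc
            (F xi - fourier (fun x => f x * \1_[set y | enorm y <= n%:R] x) xi)
          ^+ 2)%:E)%E @ \oo --> 0%E].

(* g = (- Delta)^alpha f, as an identity in L^2: the multiplier |xi|^(2 alpha). *)
Definition frac_laplacian (alpha : R) f g : Prop :=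
  [/\ L2 f, L2 g & exists2 F, is_fourierL2 f F &
      is_fourierL2 g (fun xi => Complex (enorm xi `^ (2 * alpha)) 0 * F xi)].

(* Lambda = (- Delta)^(1/2), so Lambda^(1/2) = (- Delta)^(1/4). *)
Definition Lambda_half f g : Prop := frac_laplacian 4^-1 f g.

(* \int |Lambda^(1/2) f|^2 dx. The set has at most one element, since
   Lambda^(1/2) f is unique up to a null set; the value is +oo when f is not in
   the domain H^(1/2) of Lambda^(1/2). *)
Definition Lambda_half_energy f : \bar R :=
  ereal_inf [set \int[mu]_x (g x ^+ 2)%:E | g in Lambda_half f]%E.

Definition H12 : set (V -> R) := [set f | exists g, Lambda_half f g].
Definition H12norm f : \bar R :=
  ((L2norm f `^ 2 + Lambda_half_energy f) `^ 2^-1)%E.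

Section Bochner.
Variables (X : set (V -> R)) (nrm : (V -> R) -> \bar R).

Definition bochner_simple (s : R -> V -> R) : Prop :=
  exists (k : nat) (A : 'I_k -> set R) (phi : 'I_k -> V -> R),
    (forall i, measurable (A i) /\ X (phi i)) /\
    forall t x, s t x = \sum_(i < k) \1_(A i) t * phi i x.

Definition bochner_measurable (T : R) (u : R -> V -> R) : Prop :=
  exists s : nat -> R -> V -> R, (forall n, bochner_simple (s n)) /\
    {ae lebesgue_measure, forall t : R, 0 < t < T ->
       (fun n => nrm (fun x => s n t x - u t x)) @ \oo --> 0%E}.

(* u represents an element of L^p(0, T; X), in the sense of Bochner: X is a space
   of functions with norm nrm, and strong measurability means a.e. limit of
   simple functions. Values of u outside ]0, T[ are irrelevant here. *)
Definition bochner_Lp (p : \bar R) (T : R) (u : R -> V -> R) : Prop :=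
  [/\ {ae lebesgue_measure, forall t : R, 0 < t < T -> X (u t)},
      bochner_measurable T u &
      ('N[lebesgue_measure]_p[(fun t : R => if (0 < t < T)%R then nrm (u t) else 0%E)]
       < +oo)%E].

End Bochner.

Definition trunc (lam : R) f : V -> R := fun x => Num.max (f x - lam) 0.

Definition level_set_energy_inequality (T : R) (theta : R -> V -> R) : Prop :=
  forall lam : R, 0 < lam ->
  forall t1 t2 : R, 0 <= t1 -> t1 < t2 -> t2 <= T ->
  (\int[mu]_x (trunc lam (theta t2) x ^+ 2)%:E
   + 2%:E * \int[lebesgue_measure]_(t in `[t1, t2])
       Lambda_half_energy (trunc lam (theta t))
   <= \int[mu]_x (trunc lam (theta t1) x ^+ 2)%:E)%E.

End Spaces.

(* Main.v *)
(* De Giorgi iteration, with a Nash inequality in place of a Sobolev embedding.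
   For f in L^1 whose half derivative g = Lambda^(1/2) f is in L^2, splitting the
   Plancherel integral of f at frequency rho gives
     |f|_2^2 <= K (rho^N |f|_1^2 + |g|_2^2 / rho)     for all rho > 0.
   Let a_k be the energy of (theta - lam_k)_+ at time t_k, lam_k = M (1 - 2^-(k+1)),
   t_k = T (1 - 2^-k). Some time in [t_k, t_k+1] has dissipation at most
   a_k / (t_k+1 - t_k), the L^1 norm of (theta - lam_k+1)_+ is at most
   a_k / (lam_k+1 - lam_k) by Chebyshev, and the energy decreases in time, so
     a_k+1 <= K (rho^N (a_k / (lam_k+1 - lam_k))^2 + a_k / (rho (t_k+1 - t_k))).
   Taking rho proportional to 2^k / T, a_k decays geometrically as soon as M^2 is a
   large multiple of |theta_0|_2^2 / T^N; then (theta(T) - M)_+ vanishes a.e.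

   Plancherel on the line comes from the weight exp (- e |xi|), whose transform is
   the Poisson kernel, as e -> 0; on R^n it follows by induction on n, transforming
   one variable at a time. *)
Require Import Defs.
From mathcomp Require Import all_boot all_order all_algebra.
From mathcomp Require Import all_classical all_reals all_analysis ess_sup_inf.
From mathcomp Require Import measurable_realfun ring lra.
From mathcomp.real_closed Require Import complex.

Set Implicit Arguments.
Unset Strict Implicit.
Unset Printing Implicit Defensive.

Import Order.TTheory GRing.Theory Num.Theory.
Import numFieldNormedType.Exports.

Local Open Scope classical_set_scope.
Local Open Scope ring_scope.

(** * Real-valued integrals *)

(** Plancherel is proved as an equality only for bounded measurable functions supported in a box;
    beyond these, two inequalities suffice. The final constant is not meant to be sharp, so passages
    to the limit may lose a factor 2 through |z|^2 <= 2 |z - w|^2 + 2 |w|^2. This fits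
    [is_fourierL2], which gives the transform of an L^2 function only as a limit of transforms of
    its ball truncations, and it is the origin of most of the numerical constants in [nash]. The
    induction on the dimension shapes the middle of the proof: once one variable is transformed, a
    real function has become complex. The statement proved by induction therefore concerns A + iB,
    kept as a pair of real functions, and all transforms are written with real cosine and sine
    integrals. In the iteration the dissipation enters as an infimum that is not shown to be
    measurable in time. Only a lower bound on its integral is used, and a finite infimum is what
    supplies a half derivative at the chosen time. *)

Section RintegralProduct.
Context d1 d2 (T1 : measurableType d1) (T2 : measurableType d2) (R : realType).
Variables (m1 : {sigma_finite_measure set T1 -> \bar R})
          (m2 : {sigma_finite_measure set T2 -> \bar R}).
Implicit Types (f : T1 * T2 -> R) (a : T1 -> R) (b : T2 -> R).

Lemma measurable_Rintegral_snd f : measurable_fun setT f ->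
  measurable_fun setT (fun x => \int[m2]_y f (x, y)).
Proof.
move=> mf; have mf' : measurable_fun [set: T1 * T2] (EFin \o f) by exact/measurable_EFinP.
rewrite /Rintegral; apply: measurableT_comp => //.
rewrite (_ : (fun x => _) = (fun x => \int[m2]_y (EFin \o f)^\+ (x, y)
   - \int[m2]_y (EFin \o f)^\- (x, y))%E); last first.
  apply/funext => x; rewrite integralE.
  by congr (_ - _)%E; apply: eq_integral => y _; rewrite ?funeposE ?funenegE.
apply: emeasurable_funB.
- by apply: measurable_fun_fubini_tonelli_F => //; exact: measurable_funepos.
- by apply: measurable_fun_fubini_tonelli_F => //; exact: measurable_funeneg.
Qed.

Lemma measurable_integral_snd (f : T1 -> T2 -> \bar R) :
  measurable_fun setT (fun u : T1 * T2 => f u.1 u.2) -> (forall x y, (0 <= f x y)%E) ->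
  measurable_fun setT (fun x => (\int[m2]_y f x y)%E).
Proof. by move=> mf f0; exact: (measurable_fun_fubini_tonelli_F _ mf (fun u => f0 u.1 u.2)). Qed.

Lemma measurable_integral_fst (f : T1 -> T2 -> \bar R) :
  measurable_fun setT (fun u : T1 * T2 => f u.1 u.2) -> (forall x y, (0 <= f x y)%E) ->
  measurable_fun setT (fun y => (\int[m1]_x f x y)%E).
Proof. by move=> mf f0; exact: (measurable_fun_fubini_tonelli_G _ mf (fun u => f0 u.1 u.2)). Qed.

Lemma integral_swap (f : T1 -> T2 -> \bar R) :
  measurable_fun setT (fun u : T1 * T2 => f u.1 u.2) -> (forall x y, (0 <= f x y)%E) ->
  (\int[m1]_x \int[m2]_y f x y = \int[m2]_y \int[m1]_x f x y)%E.
Proof. by move=> mf f0; exact: (fubini_tonelli _ mf (fun u => f0 u.1 u.2)). Qed.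

Section dominated.
Variables (f : T1 * T2 -> R) (a : T1 -> R) (b : T2 -> R).
Hypotheses (mf : measurable_fun setT f)
  (ia : m1.-integrable setT (EFin \o a)) (ib : m2.-integrable setT (EFin \o b)).
Hypothesis fab : forall x y, `|f (x, y)| <= a x * b y.

Lemma integrable_snd x : m2.-integrable setT (fun y => (f (x, y))%:E).
Proof.
apply: (@le_integrable _ _ _ _ _ _ _ (fun y => ((a x)%:E * (b y)%:E)%E)) => //.
- by apply/measurable_EFinP; apply: measurableT_comp => //.
- by move=> y _; rewrite -EFinM /= lee_fin (le_trans (fab x y))// ler_norm.
- by apply: integrableZl.
Qed.

Lemma integrable_fst y : m1.-integrable setT (fun x => (f (x, y))%:E).
Proof.
apply: (@le_integrable _ _ _ _ _ _ _ (fun x => ((b y)%:E * (a x)%:E)%E)) => //.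
- by apply/measurable_EFinP; apply: measurableT_comp => //.
- by move=> x _; rewrite -EFinM /= lee_fin mulrC (le_trans (fab x y))// ler_norm.
- by apply: integrableZl.
Qed.

(** Tonelli applied to |a| |b|. Domination by a tensor product of integrable functions is the only
    form in which signed integrals are exchanged below. *)
Lemma dominated_prod_integrable : (m1 \x m2)%E.-integrable setT (EFin \o f).
Proof.
apply/integrable12ltyP; first exact/measurable_EFinP.
apply: (@le_lt_trans _ _ (\int[m1]_x (`|a x|%:E * \int[m2]_y `|b y|%:E)%E)%E).
  apply: ge0_le_integral => //.
  - by move=> x _; apply: integral_ge0.
  - apply: (measurable_fun_fubini_tonelli_F (abse \o (EFin \o f))) => //=.
    by apply: measurableT_comp => //; exact/measurable_EFinP.
  - apply: emeasurable_funM; last exact: measurable_cst.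
    apply/measurable_EFinP/measurableT_comp => //.
    by apply/measurable_EFinP; exact: measurable_int ia.
  - move=> x _; rewrite -ge0_integralZl//; last first.
    + apply/measurable_EFinP/measurableT_comp => //.
      by apply/measurable_EFinP; exact: measurable_int ib.
    + apply: ge0_le_integral => //.
      * apply/measurableT_comp => //; apply/measurable_EFinP.
        by apply: measurableT_comp.
      * apply: emeasurable_funM => //; apply/measurable_EFinP/measurableT_comp => //.
        by apply/measurable_EFinP; exact: measurable_int ib.
      * by move=> y _; rewrite -EFinM /= lee_fin -normrM (le_trans (fab x y))// ler_norm.
have [_ lta] := integrableP _ _ _ ia; have [_ ltb] := integrableP _ _ _ ib.
rewrite ge0_integralZr//=.
- by apply: lte_mul_pinfty => //; [exact: integral_ge0|
    rewrite ge0_fin_numE//; exact: integral_ge0].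
- apply/measurable_EFinP/measurableT_comp => //.
  by apply/measurable_EFinP; exact: measurable_int ia.
- exact: integral_ge0.
Qed.

(** The bound [fab] holds at every point, so every inner integral is finite and taking [fine] of it
    loses nothing. *)
Lemma Rintegral_snd_integrable :
  m1.-integrable setT (EFin \o (fun x => \int[m2]_y f (x, y))).
Proof.
apply: eq_integrable (integrable_fubini_F dominated_prod_integrable) => // x _.
rewrite /fubini_F /comp /Rintegral fineK//.
exact: (integrable_fin_num _ (integrable_snd x)).
Qed.

Lemma Rintegral_prod1 :
  \int[m1]_x \int[m2]_y f (x, y) = \int[(m1 \x m2)%E]_z f z.
Proof.
rewrite /Rintegral; congr fine.
rewrite -(integral12_prod_meas1 dominated_prod_integrable).
apply: eq_integral => x _; rewrite fineK//.
exact: (integrable_fin_num _ (integrable_snd x)).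
Qed.

Lemma Rintegral_prod2 :
  \int[m2]_y \int[m1]_x f (x, y) = \int[(m1 \x m2)%E]_z f z.
Proof.
rewrite /Rintegral; congr fine.
rewrite -(integral21_prod_meas1 dominated_prod_integrable).
apply: eq_integral => x _; rewrite fineK//.
exact: (integrable_fin_num _ (integrable_fst x)).
Qed.

Lemma Rintegral_swap :
  \int[m1]_x \int[m2]_y f (x, y) = \int[m2]_y \int[m1]_x f (x, y).
Proof. by rewrite Rintegral_prod1 -Rintegral_prod2. Qed.

End dominated.
End RintegralProduct.

Section RintegralDomination.
Context d (T : measurableType d) (R : realType).
Variable m : {measure set T -> \bar R}.
Implicit Types (f g : T -> R).

Lemma le_Rintegrable f g : measurable_fun setT f -> (forall x, `|f x| <= g x) ->
  m.-integrable setT (EFin \o g) -> m.-integrable setT (EFin \o f).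
Proof.
move=> mf fg; apply: le_integrable => //; first exact/measurable_EFinP.
by move=> x _; rewrite lee_fin (le_trans (fg x))// ler_norm.
Qed.

Lemma normr_Rintegral_le f g : measurable_fun setT f -> (forall x, `|f x| <= g x) ->
  m.-integrable setT (EFin \o g) -> `|\int[m]_x f x| <= \int[m]_x g x.
Proof.
move=> mf fg ig; have ifn := le_Rintegrable mf fg ig.
apply: le_trans (le_normr_Rintegral _ _) _ => //.
by apply: le_Rintegral => //; exact: (integrable_norm ifn).
Qed.

Lemma cvg_Rintegral_dominated (f_ : nat -> T -> R) f g :
  (forall n, measurable_fun setT (f_ n)) -> measurable_fun setT f ->
  (forall x, f_ ^~ x @ \oo --> f x) -> (forall n x, `|f_ n x| <= g x) ->
  m.-integrable setT (EFin \o g) ->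
  \int[m]_x f_ n x @[n --> \oo] --> \int[m]_x f x.
Proof.
move=> mf_ mf f_f f_g ig.
have [] := @dominated_convergence _ _ _ m setT measurableT
    (fun n => EFin \o f_ n) (EFin \o f) (EFin \o g).
- by move=> n; exact/measurable_EFinP.
- exact/measurable_EFinP.
- by apply: aeW => x _; apply: cvg_EFin; [exact: nearW|exact: f_f].
- exact: ig.
- by apply: aeW => x n _; rewrite lee_fin.
move=> ifn _ fc; apply: fine_cvg; rewrite fineK//.
exact: integrable_fin_num ifn.
Qed.

Lemma Rintegral_EFin f : m.-integrable setT (EFin \o f) ->
  (\int[m]_x (f x)%:E = (\int[m]_x f x)%R%:E)%E.
Proof. by move=> fi; rewrite fineK//; exact: integrable_fin_num fi. Qed.

End RintegralDomination.

Section MeasurableTrigo.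
Context d (T : measurableType d) (R : realType).
Implicit Types f : T -> R.

Lemma measurable_cos f : measurable_fun setT f -> measurable_fun setT (fun x => cos (f x)).
Proof.
apply: (@measurableT_comp _ _ _ _ _ _ (@cos R)); apply: continuous_measurable_fun.
exact: continuous_cos.
Qed.

Lemma measurable_sin f : measurable_fun setT f -> measurable_fun setT (fun x => sin (f x)).
Proof.
apply: (@measurableT_comp _ _ _ _ _ _ (@sin R)); apply: continuous_measurable_fun.
exact: continuous_sin.
Qed.

End MeasurableTrigo.

Ltac solve_measurable := repeat first
  [ exact: measurable_cst | exact: measurable_id
  | exact: measurable_fst | exact: measurable_snd
  | apply: measurable_funM | apply: measurable_funB | apply: measurable_funD
  | apply: measurable_funX | apply: measurable_cos | apply: measurable_sin
  | apply: measurable_Rintegral_snd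
  | (apply: measurableT_comp; [solve [assumption|exact: measurable_id]|])
  | assumption ].

(** * The Poisson kernel *)

Section PoissonKernel.
Context {R : realType}.
Local Notation mu := (@lebesgue_measure R).
Implicit Types (e z x xi : R).

Definition exp_weight e xi : R := expR (- (e * `|xi|)).
(** Normalized without 1 / pi: the total mass is [pi], and the kernel is half the cosine transform
    of [exp_weight e]. *)
Definition poisson e z : R := e / (e ^+ 2 + z ^+ 2).

Lemma cvg_expRMN e : 0 < e -> expR (- (e * x)) @[x --> +oo] --> (0 : R).
Proof.
move=> e0; apply: (@cvg_comp _ _ _ (fun x => e * x) (fun y => expR (- y)) _ (pinfty_nbhs R)).
  by apply: gt0_cvgMry => //; exact: cvg_id.
exact: cvgr_expR.
Qed.

Lemma cvg_expRMN_bounded e (g : R -> R) M : 0 < e -> (forall x, `|g x| <= M) ->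
  expR (- (e * x)) * g x @[x --> +oo] --> (0 : R).
Proof.
move=> e0 gM; apply/cvgrPdist_le => d d0.
have M0 : 0 <= M by apply: le_trans (gM 0).
have d'0 : 0 < d / (M + 1) by rewrite divr_gt0// ltr_wpDl.
have /cvgrPdist_le/(_ _ d'0) := cvg_expRMN e0.
apply: filterS => x; rewrite !sub0r !normrN => h; rewrite normrM.
apply: (@le_trans _ _ (d / (M + 1) * (M + 1))).
  by apply: ler_pM => //; apply: (le_trans (gM x)); rewrite lerDl.
by rewrite divfK// gt_eqF// ltr_wpDl.
Qed.

Lemma denom_gt0 e z : 0 < e -> 0 < e ^+ 2 + z ^+ 2.
Proof. by move=> e0; rewrite ltr_pwDl ?exprn_gt0 ?sqr_ge0. Qed.

Lemma poisson_ge0 e z : 0 < e -> 0 <= poisson e z.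
Proof. by move=> e0; rewrite divr_ge0 ?ltW// denom_gt0. Qed.

(** The antiderivative of exp (- e xi) (1 + cos (z xi)) that tends to 0 at +oo, so the integral over
    the half line is minus its value at 0. *)
Let primitive e z xi :=
  expR (- (e * xi)) * ((z * sin (z * xi) - e * cos (z * xi)) / (e ^+ 2 + z ^+ 2) - e^-1).

Let is_derive_primitive e z xi : 0 < e ->
  is_derive xi 1 (primitive e z) (expR (- (e * xi)) * (1 + cos (z * xi))).
Proof.
move=> e0; have d0 := denom_gt0 z e0.
rewrite /primitive.
apply: is_derive_eq.
rewrite /GRing.scale/=.
by field; rewrite !gt_eqF.
Qed.

Let cvg_primitive e z : 0 < e -> primitive e z xi @[xi --> +oo] --> (0 : R).
Proof.
move=> e0; apply: (@cvg_expRMN_bounded _ _ ((`|z| + e) / (e ^+ 2 + z ^+ 2) + e^-1)) => //.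
move=> xi; have d0 := denom_gt0 z e0.
apply: (le_trans (ler_normB _ _)); rewrite normfV (gtr0_norm e0) lerD2r.
rewrite normrM normfV (gtr0_norm d0) ler_pM2r ?invr_gt0//.
apply: (le_trans (ler_normB _ _)); rewrite !normrM (gtr0_norm e0) lerD//.
- by rewrite ler_piMr// sin_max.
- by rewrite ler_piMr ?cos_max// ltW.
Qed.

Lemma continuous_exp_weight e : continuous (exp_weight e).
Proof.
move=> x; apply: continuous_comp; last exact: continuous_expR.
apply: continuousN; apply: continuousM; first exact: cst_continuous.
exact: norm_continuous.
Qed.

Lemma continuous_cosM z : continuous (fun xi : R => cos (z * xi)).
Proof.
move=> x; apply: (continuous_comp (f := fun xi => z * xi)); last exact: continuous_cos.
by apply: continuousM; [exact: cst_continuous|exact: id].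
Qed.

Let cosD1_ge0 x : 0 <= 1 + cos x.
Proof. by rewrite -lerBlDl sub0r cos_geN1. Qed.

(** The 1 added to the cosine makes the integrand nonnegative, so evenness and the fundamental
    theorem of calculus on a half line apply before integrability is known. The case z = 0 gives the
    mass of the weight; removing it leaves the cosine transform. *)
Lemma integral_exp_weight_1Dcos e z : 0 < e ->
  (\int[mu]_xi (exp_weight e xi * (1 + cos (z * xi)))%:E
   = (2 * (e^-1 + poisson e z))%:E)%E.
Proof.
move=> e0; have cc : continuous (fun xi => exp_weight e xi * (1 + cos (z * xi))).
  move=> x; apply: continuousM; first exact: continuous_exp_weight.
  by apply: continuousD; [exact: cst_continuous|exact: continuous_cosM].
rewrite ge0_symfun_integralT//; last 2 first.
- by move=> x; rewrite mulr_ge0// expR_ge0.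
- by move=> x /=; rewrite /exp_weight normrN mulrN cosN.
rewrite [X in (_ * X)%E](_ : _ = (e^-1 + poisson e z)%:E)//.
rewrite -set_itvcy.
transitivity (\int[mu]_(xi in `[0%R, +oo[) (expR (- (e * xi)) * (1 + cos (z * xi)))%:E)%E.
  by apply: eq_integral => x; rewrite inE/= in_itv/= andbT => x0; rewrite /exp_weight ger0_norm.
have d0 := denom_gt0 z e0.
have cf : continuous (fun xi : R => expR (- (e * xi)) * (1 + cos (z * xi))).
  by move=> x; apply/differentiable_continuous/derivable1_diffP; exact: ex_derive.
rewrite (@ge0_continuous_FTC2y _ _ (primitive e z) _ 0).
  - rewrite -EFinB; congr EFin; rewrite /primitive /poisson !mulr0 oppr0 expR0 sin0 cos0.
    by field; rewrite !gt_eqF.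
  - by move=> x _; rewrite mulr_ge0// expR_ge0.
  - exact: continuous_subspaceT.
  - exact: cvg_primitive.
  - by move=> x _; have := is_derive_primitive z x e0; case.
  - apply: cvg_at_right_filter.
    by apply/differentiable_continuous/derivable1_diffP; have := is_derive_primitive z 0 e0; case.
  - by move=> x _; have := is_derive_primitive z x e0; rewrite derive1E => /(@derive_val _ _ _ _ _ _ _).
Qed.

Lemma integral_exp_weight e : 0 < e -> (\int[mu]_xi (exp_weight e xi)%:E = (2 / e)%:E)%E.
Proof.
move=> e0; have := integral_exp_weight_1Dcos 0 e0.
under eq_integral do rewrite mul0r cos0 EFinM.
have me : measurable_fun setT (fun x : R => (exp_weight e x)%:E).
  by apply/measurable_EFinP; apply: continuous_measurable_fun; exact: continuous_exp_weight.
rewrite ge0_integralZr//; last by move=> x _; rewrite lee_fin expR_ge0.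
move=> h; have : (\int[mu]_xi (exp_weight e xi)%:E * 2%:E * (2^-1)%:E = (2 / e)%:E * 2%:E * (2^-1)%:E)%E.
  rewrite [X in (X * _)%E]h -!EFinM; congr EFin; rewrite /poisson expr0n addr0.
  by field; rewrite gt_eqF.
by rewrite -!muleA -!EFinM divff ?mulr1 ?mule1// pnatr_eq0.
Qed.

Lemma integrable_exp_weight e : 0 < e -> mu.-integrable setT (EFin \o exp_weight e).
Proof.
move=> e0; apply/integrableP; split.
  by apply/measurable_EFinP; apply: continuous_measurable_fun; exact: continuous_exp_weight.
under eq_integral do rewrite /= ger0_norm ?expR_ge0//.
by rewrite integral_exp_weight// ltry.
Qed.

Lemma Rintegral_exp_weight_cos e z : 0 < e ->
  \int[mu]_xi (exp_weight e xi * cos (z * xi)) = 2 * poisson e z.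
Proof.
move=> e0.
have ie := integrable_exp_weight e0.
have ic : mu.-integrable setT (EFin \o (fun xi => exp_weight e xi * cos (z * xi))).
  apply: le_integrable ie => //.
    apply/measurable_EFinP/measurable_funM; apply: continuous_measurable_fun.
      exact: continuous_exp_weight.
    exact: continuous_cosM.
  move=> x _; rewrite /= lee_fin normrM ler_piMr// ler_norml cos_geN1 cos_le1//.
have : \int[mu]_xi (exp_weight e xi + exp_weight e xi * cos (z * xi)) = 2 / e + 2 * poisson e z.
  rewrite /Rintegral; under eq_integral do rewrite -{1}(mulr1 (exp_weight e _)) -mulrDr.
  by rewrite integral_exp_weight_1Dcos//= mulrDr.
rewrite RintegralD// [X in X + _]/Rintegral integral_exp_weight//= => /addrI.
exact.
Qed.

End PoissonKernel.

(** * The Poisson kernel as an approximate identity *)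

Section PoissonApproximation.
Context {R : realType}.
Local Notation mu := (@lebesgue_measure R).
Implicit Types (e z x xi : R).

Lemma continuous_poissonB e x : 0 < e -> continuous (fun y : R => poisson e (x - y)).
Proof.
move=> e0 y; apply: cvgM; first exact: cvg_cst.
apply: cvgV; first by rewrite gt_eqF// denom_gt0.
apply: cvgD; first exact: cvg_cst.
rewrite (_ : (fun z => _) = (fun z : R => (x - z) * (x - z))); last by apply/funext => z; rewrite expr2.
by apply: cvgM; (apply: cvgB; [exact: cvg_cst|exact: cvg_id]).
Qed.

(** With y = x + e z the scale leaves the kernel and enters the argument of [G]; for bounded [G] the
    integrands then share one majorant as e tends to 0. *)
Lemma integral_poisson_subst e x (G : R -> R) : 0 < e -> continuous G ->
  (forall y, 0 <= G y) ->
  (\int[mu]_y (G y * poisson e (x - y))%:E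
   = \int[mu]_z (G (x + e * z) * (1 + z ^+ 2)^-1)%:E)%E.
Proof.
move=> e0 cG G0.
have dF z : is_derive z 1 (fun z : R => x + e * z) e.
  by apply: is_derive_eq; rewrite /GRing.scale /=; ring.
have F'E : derive1 (fun z : R => x + e * z) = cst e.
  by apply/funext => z; rewrite derive1E derive_val.
rewrite (@increasing_ge0_integration_by_substitutionT _ (fun z => x + e * z)).
- apply: eq_integral => z _; rewrite F'E; congr EFin.
  change (G (x + e * z) * poisson e (x - (x + e * z)) * e = G (x + e * z) * (1 + z ^+ 2)^-1).
  rewrite /poisson (_ : _ + _ = e ^+ 2 * (1 + z ^+ 2)); last by ring.
  have z0 : 1 + z ^+ 2 != 0 by rewrite gt_eqF// ltr_pwDl// sqr_ge0.
  by field; rewrite z0 gt_eqF.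
- by move=> a b ab; rewrite ltrD2l ltr_pM2l.
- by rewrite F'E => z; exact: cst_continuous.
- by rewrite F'E; apply: is_cvg_cst.
- by rewrite F'E; apply: is_cvg_cst.
- by move=> z; have [] := dF z.
- apply: (@cvg_comp _ _ _ (fun z => e * z) (fun y => x + y) _ (ninfty_nbhs R)); last exact: cvg_addrl_Ny.
  by apply: gt0_cvgMrNy => //; exact: cvg_id.
- apply: (@cvg_comp _ _ _ (fun z => e * z) (fun y => x + y) _ (pinfty_nbhs R)); last exact: cvg_addrl.
  by apply: gt0_cvgMry => //; exact: cvg_id.
- by move=> y; apply: cvgM; [exact: cG|exact: continuous_poissonB].
- by move=> y; rewrite mulr_ge0// poisson_ge0.
Qed.

Lemma integral_inv1Dsqr : (\int[mu]_z ((1 + z ^+ 2)^-1)%:E = (pi : R)%:E)%E.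
Proof.
have := @integral0y_oneDsqr R; rewrite set_itvcy => h.
rewrite ge0_symfun_integralT.
- by rewrite [X in (_ * X)%E]h -EFinM mulrC divfK.
- by move=> z; rewrite invr_ge0 addr_ge0// sqr_ge0.
- exact: (@continuous_oneDsqrV R).
- by move=> z /=; rewrite sqrrN.
Qed.

Lemma integral_poisson e x : 0 < e ->
  (\int[mu]_y (poisson e (x - y))%:E = (pi : R)%:E)%E.
Proof.
move=> e0; rewrite -integral_inv1Dsqr.
have := @integral_poisson_subst e x (cst 1) e0.
under eq_integral do rewrite mul1r.
under [in RHS]eq_integral do rewrite mul1r.
by apply => // y; exact: cst_continuous.
Qed.

Lemma integrable_poisson e x : 0 < e ->
  mu.-integrable setT (EFin \o (fun y => poisson e (x - y))).
Proof.
move=> e0; apply/integrableP; split.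
  apply/measurable_EFinP; apply: continuous_measurable_fun.
  exact: continuous_poissonB.
under eq_integral do rewrite /= ger0_norm ?poisson_ge0//.
by rewrite integral_poisson// ltry.
Qed.

Lemma cvg_poisson (psi : R -> R) M x : continuous psi -> (forall y, `|psi y| <= M) ->
  \int[mu]_y (psi y * poisson n.+1%:R^-1 (x - y)) @[n --> \oo] --> pi * psi x.
Proof.
move=> cpsi psiM.
(* The substitution is stated for nonnegative functions; the shift by [M] is taken back below
   through the mass [pi] of the kernel. *)
pose G y := psi y + M.
have cG : continuous G by move=> y; apply: cvgD; [exact: cpsi|exact: cvg_cst].
have G0 y : 0 <= G y by have /ler_normlP[+ _] := psiM y; rewrite -subr_ge0 opprK addrC.
have GM y : G y <= 2 * M.
  by have /ler_normlP[_] := psiM y; rewrite -(lerD2r M) mulr_natl mulr2n.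
have e0 n : (0 : R) < n.+1%:R^-1 by [].
have ip n := integrable_poisson x (e0 n).
have mpsi : measurable_fun setT psi by exact: continuous_measurable_fun.
have ipsi n : mu.-integrable setT (EFin \o (fun y => psi y * poisson n.+1%:R^-1 (x - y))).
  apply: (le_integrable measurableT _ _ (integrableZl measurableT M (ip n))).
  - apply/measurable_EFinP; apply: measurable_funM => //.
    by apply: continuous_measurable_fun; exact: continuous_poissonB.
  - move=> y _; rewrite -EFinM lee_fin !normrM ler_wpM2r//.
    by rewrite (le_trans (psiM y))// ler_norm.
have minv : measurable_fun setT (fun z : R => (1 + z ^+ 2)^-1).
  by apply: continuous_measurable_fun; exact: (@continuous_oneDsqrV R).
have iinv1 : mu.-integrable setT (fun z : R => ((1 + z ^+ 2)^-1)%:E).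
  apply/integrableP; split; first exact/measurable_EFinP.
  under eq_integral => z _ do rewrite gee0_abs ?lee_fin ?invr_ge0 ?addr_ge0 ?sqr_ge0//.
  by rewrite integral_inv1Dsqr ltry.
have iinv k : mu.-integrable setT (fun z : R => (k * (1 + z ^+ 2)^-1)%:E).
  exact: (integrableZl measurableT k iinv1).
have lim : (\int[mu]_z (G (x + n.+1%:R^-1 * z) * (1 + z ^+ 2)^-1)%:E @[n --> \oo] -->
    \int[mu]_z (G x * (1 + z ^+ 2)^-1)%:E)%E.
  have mG : measurable_fun setT G by exact: continuous_measurable_fun.
  have [//|//|//|//|//|] := @dominated_convergence _ _ _ mu setT measurableT
    (fun n z => (G (x + n.+1%:R^-1 * z) * (1 + z ^+ 2)^-1)%:E)
    (fun z => (G x * (1 + z ^+ 2)^-1)%:E) (fun z => (2 * M * (1 + z ^+ 2)^-1)%:E).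
  - move=> n; apply/measurable_EFinP/measurable_funM => //.
    apply: (measurableT_comp mG); apply: measurable_funD => //; exact: mulrl_measurable.
  - by apply/measurable_EFinP; apply: measurable_funM.
  - apply: aeW => z _; apply: cvg_EFin; first exact: nearW.
    apply: cvgM; last exact: cvg_cst.
    apply: (@cvg_comp _ _ _ (fun n => x + n.+1%:R^-1 * z) G _ (nbhs x)); last exact: cG.
    have h : (fun n => x + n.+1%:R^-1 * z) @ \oo --> x + 0 * z.
      apply: cvgD; first exact: cvg_cst.
      by apply: cvgM; [exact: cvg_harmonic|exact: cvg_cst].
    by rewrite mul0r addr0 in h.
  - apply: aeW => z n _.
    have q0 : 0 <= (1 + z ^+ 2)^-1 by rewrite invr_ge0 addr_ge0 ?sqr_ge0.
    by rewrite lee_fin ger0_norm ?(mulr_ge0 (G0 _) q0)// ler_wpM2r// GM.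
  by move=> _ _.
have GE n : \int[mu]_y (psi y * poisson n.+1%:R^-1 (x - y))
    = fine (\int[mu]_z (G (x + n.+1%:R^-1 * z) * (1 + z ^+ 2)^-1)%:E)%E - M * pi.
  rewrite -integral_poisson_subst//.
  under eq_integral do rewrite mulrDl.
  rewrite -[X in X - _]/(\int[mu]_y (psi y * poisson n.+1%:R^-1 (x - y) + M * poisson n.+1%:R^-1 (x - y))).
  rewrite RintegralD//; last exact: (integrableZl measurableT M (ip n)).
  rewrite (@RintegralZl _ _ _ mu setT (fun y => poisson n.+1%:R^-1 (x - y)) M)//.
  have -> : \int[mu]_y poisson n.+1%:R^-1 (x - y) = pi by rewrite /Rintegral integral_poisson.
  by rewrite addrK.
under eq_cvg do rewrite GE.
have -> : pi * psi x = fine (\int[mu]_z (G x * (1 + z ^+ 2)^-1)%:E)%E - M * pi.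
  under eq_integral do rewrite EFinM.
  rewrite ge0_integralZl//.
  - by rewrite integral_inv1Dsqr/= /G; ring.
  - exact/measurable_EFinP.
  - by move=> z _; rewrite lee_fin invr_ge0 addr_ge0 ?sqr_ge0.
  - by rewrite lee_fin.
apply: cvgB; last exact: cvg_cst.
apply: fine_cvg; rewrite fineK//.
exact: (integrable_fin_num measurableT (iinv _)).
Qed.

End PoissonApproximation.

(** * Bounded functions with compact support and their continuous approximation *)

Section CompactlySupported.
Context {R : realType}.
Local Notation mu := (@lebesgue_measure R).
Implicit Types (h psi : R -> R) (M r e : R).

Definition box1 r : R -> R := \1_`[- r, r].

Lemma integrable_box1 M r : mu.-integrable setT (EFin \o (fun x => M * box1 r x)).
Proof. exact: (integrableZl measurableT M (integrable_indic_itv _ _ _ _)). Qed.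

Lemma box1_le1 r x : box1 r x <= 1.
Proof. by rewrite /box1 indicE lern1 leq_b1. Qed.

Lemma box1_ge0 r x : 0 <= box1 r x.
Proof. by rewrite /box1 indicE. Qed.

Lemma box1E r x : box1 r x = (`|x| <= r)%R%:R.
Proof. by rewrite /box1 indicE mem_setE in_itv/= -ler_norml. Qed.

(** One inequality carries both the bound [M] and the support in [-r, r]. Only measurability is
    asked besides, since slices of truncated L^2 functions offer no more. *)
Definition bounded_cs M r h :=
  measurable_fun setT h /\ forall x, `|h x| <= M * box1 r x.

Lemma bounded_cs_ge0 M r h : bounded_cs M r h -> 0 <= r -> 0 <= M.
Proof.
move=> [_ /(_ 0)] + r0; rewrite box1E normr0 r0 mulr1; exact: le_trans.
Qed.

Lemma bounded_cs_le M r h x : bounded_cs M r h -> `|h x| <= `|M|.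
Proof.
move=> [_ /(_ x)] /le_trans; apply; apply: (le_trans (ler_norm _)).
by rewrite normrM (ger0_norm (box1_ge0 _ _)) ler_piMr// box1_le1.
Qed.

Lemma bounded_cs_integrable M r h : bounded_cs M r h ->
  mu.-integrable setT (EFin \o h).
Proof.
move=> [mh hM]; exact: (@le_Rintegrable _ _ _ mu _ _ mh hM (integrable_box1 M r)).
Qed.

(** Density of continuous functions in L^1 of a bounded interval gives [g_ n]. Clipping it to
    [-M, M] and multiplying it by a cut-off equal to 1 on [-r, r] cannot increase the distance to
    [h], which is bounded by [M] and vanishes off [-r, r]. The result keeps the uniform bound that
    [cvg_poisson] asks for. *)
Lemma bounded_cs_continuous_approx M r h d : bounded_cs M r h -> 0 <= r -> 0 < d ->
  exists psi, [/\ continuous psi, forall y, `|psi y| <= M &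
    (\int[mu]_y `|h y - psi y|%:E < d%:E)%E].
Proof.
move=> hb r0 d0; have M0 := bounded_cs_ge0 hb r0; have hM := @bounded_cs_le _ _ _ ^~ hb.
rewrite (ger0_norm M0) in hM.
(* The unit of room beyond [r] lets the cut-off [chi] fall continuously from 1 to 0 where [h]
   vanishes. *)
pose s := r + 1; have s0 : 0 <= s by rewrite addr_ge0.
pose E := `[- s, s]%classic.
have mE : measurable E by exact: measurable_itv.
have Efin : (mu E < +oo)%E.
  by rewrite lebesgue_measure_itv/=; case: ifP => _; rewrite ?ltry// -EFinD ltry.
have ihE : mu.-integrable E (EFin \o h).
  by apply: integrableS (bounded_cs_integrable hb).
have [g_ [cg ig]] := approximation_continuous_integrable mE Efin ihE.
have mh : measurable_fun setT h by case: hb.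
move=> /fine_cvgP[finI] /cvgrPdist_lt/(_ _ d0) lim.
have [n [fn ln]] : exists n, (\int[mu]_(z in E) `|(h z - g_ n z)%:E|)%E \is a fin_num /\
    `|0 - fine (\int[mu]_(z in E) `|(h z - g_ n z)%:E|)%E| < d.
  by near \oo => n; exists n; split; near: n.
pose phi (y : R) : R := Num.max (- M) (Num.min M (g_ n y)).
pose chi (y : R) : R := Num.max 0 (Num.min 1 (s - `|y|)).
have phiM y : `|phi y| <= M.
  rewrite ler_norml le_max lexx/= ge_max ge_min lexx andbT.
  by rewrite (le_trans _ M0)// oppr_le0.
have cmax (f g : R -> R) : continuous f -> continuous g -> continuous (fun y => Num.max (f y) (g y)).
  by move=> cf cg' y; exact: (@continuous_max _ _ f g y (cf y) (cg' y)).
have cmin (f g : R -> R) : continuous f -> continuous g -> continuous (fun y => Num.min (f y) (g y)).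
  by move=> cf cg' y; exact: (@continuous_min _ _ f g y (cf y) (cg' y)).
have ccst (a : R) : continuous (fun _ : R => a) by move=> y; exact: cvg_cst.
have cchi : continuous chi.
  apply: cmax => //; apply: cmin => // y.
  by apply: cvgB; [exact: cvg_cst|exact: norm_continuous].
have cphi : continuous phi by apply: cmax => //; exact: cmin.
have chi01 y : 0 <= chi y <= 1 by rewrite le_max lexx/= ge_max ler01 ge_min lexx.
exists (fun y => chi y * phi y); split.
- by move=> y; apply: cvgM; [exact: cchi|exact: cphi].
- move=> y; rewrite normrM -[leRHS]mul1r ler_pM//.
  by have /andP[c0 c1] := chi01 y; rewrite ger0_norm.
have pt y : `|h y - chi y * phi y| <= `|h y - g_ n y| * \1_E y.
  rewrite /E -/(box1 s y) box1E.
  have [yr|ry] := leP `|y| r.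
    have -> : chi y = 1.
      rewrite /chi (min_idPl _) ?(max_idPr _)//.
      by rewrite /s lerBrDr addrC lerD2r.
    rewrite (le_trans yr) ?lerDl// mulr1 mul1r.
    have /ler_normlP[h1 h2] := hM y; rewrite /phi.
    have [gM|Mg] := leP (g_ n y) M; last first.
      rewrite (max_idPr _) ?(le_trans _ M0) ?oppr_le0//.
      rewrite !ler0_norm ?subr_le0//; last exact: (le_trans h2 (ltW Mg)).
      by rewrite !opprB lerD2r ltW.
    have [//|gM'] := leP (- M) (g_ n y).
    rewrite opprK !ger0_norm ?subr_ge0; [|apply: (le_trans (ltW gM'))|]; try lra.
  have -> : h y = 0.
    apply/eqP; rewrite -normr_le0; have [_ /(_ y)] := hb.
    by rewrite box1E (leNgt _ r) ry mulr0.
  have [ys|sy] := leP `|y| s; last first.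
    have -> : chi y = 0.
      rewrite /chi (max_idPl _)// ge_min; apply/orP; right.
      by rewrite subr_le0 ltW.
    by rewrite mul0r subr0 normr0 mulr0.
  rewrite mulr1 !sub0r !normrN normrM.
  apply: (@le_trans _ _ `|phi y|).
    by have /andP[c0 c1] := chi01 y; rewrite ler_piMl// ger0_norm.
  rewrite /phi; have [gM|Mg] := leP (g_ n y) M; last first.
    rewrite (max_idPr _) ?(le_trans _ M0) ?oppr_le0//.
    by rewrite !ger0_norm ?(ltW Mg)// (le_trans M0)// ltW.
  have [//|gM'] := leP (- M) (g_ n y).
  rewrite normrN (ger0_norm M0) ler0_norm; last by lra.
  by lra.
apply: (@le_lt_trans _ _ (\int[mu]_(z in E) `|(h z - g_ n z)%:E|)%E); last first.
  by rewrite -(fineK fn) lte_fin; apply: le_lt_trans ln; rewrite sub0r normrN ler_norm.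
rewrite [leRHS]integral_mkcond; apply: ge0_le_integral => //.
- apply/measurable_EFinP/measurableT_comp => //; apply: measurable_funB => //.
  by apply: continuous_measurable_fun => y; apply: cvgM; [exact: cchi|exact: cphi].
- apply/(measurable_restrict _ _ _) => //; apply: measurable_funTS.
  apply: measurableT_comp => //; apply/measurable_EFinP; apply: measurable_funB => //.
  exact: continuous_measurable_fun.
- move=> y _; rewrite patchE; have := pt y; rewrite indicE; case: ifPn => _.
    by rewrite mulr1 lee_fin.
  by rewrite mulr0 lee_fin.
Unshelve. all: by end_near. Qed.

End CompactlySupported.

(** * The bilinear form of the Poisson kernel *)

Section PoissonForm.
Context {R : realType}.
Local Notation mu := (@lebesgue_measure R).
Implicit Types (h psi k : R -> R) (M r e : R).

Definition poisson_form e h k : R :=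
  \int[mu]_x (h x * \int[mu]_y (k y * poisson e (x - y))).

Lemma measurable_poissonB e : 0 < e ->
  measurable_fun setT (fun u : R * R => poisson e (u.1 - u.2)).
Proof.
move=> e0; have mp : measurable_fun setT (poisson e).
  have := continuous_measurable_fun (@continuous_poissonB R e 0 e0).
  rewrite (_ : (fun y : R => _) = poisson e)//.
  by apply/funext => y; rewrite /poisson sub0r sqrrN.
by apply: measurableT_comp => //; exact: measurable_funB.
Qed.

Lemma poissonB_sym e (x y : R) : poisson e (x - y) = poisson e (y - x).
Proof. by rewrite /poisson -(opprB y) sqrrN. Qed.

Lemma integrableM_poisson e x k M : 0 < e -> measurable_fun setT k ->
  (forall y, `|k y| <= M) ->
  mu.-integrable setT (EFin \o (fun y : R => k y * poisson e (x - y))).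
Proof.
move=> e0 mk kM.
have ip := integrableZl measurableT M (integrable_poisson x e0).
apply: (@le_Rintegrable _ _ _ mu _ (fun y : R => M * poisson e (x - y))) => //.
- apply: measurable_funM => //; apply: continuous_measurable_fun.
  exact: continuous_poissonB.
- by move=> y; rewrite normrM (ger0_norm (poisson_ge0 _ e0)) ler_wpM2r// poisson_ge0.
Qed.

Lemma normr_poisson_int_le e x k M : 0 < e -> measurable_fun setT k ->
  (forall y, `|k y| <= M) -> `|\int[mu]_y (k y * poisson e (x - y))| <= M * pi.
Proof.
move=> e0 mk kM.
have ip := integrable_poisson x e0.
have -> : M * pi = \int[mu]_y (M * poisson e (x - y)).
  by rewrite (@RintegralZl _ _ _ mu setT (fun y : R => poisson e (x - y)))// /Rintegral integral_poisson.
apply: normr_Rintegral_le.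
- apply: measurable_funM => //; apply: continuous_measurable_fun.
  exact: continuous_poissonB.
- by move=> y; rewrite normrM (ger0_norm (poisson_ge0 _ e0)) ler_wpM2r// poisson_ge0.
- exact: (integrableZl measurableT M ip).
Qed.

Lemma measurable_poisson_int e k : 0 < e -> measurable_fun setT k ->
  measurable_fun setT (fun x : R => \int[mu]_y (k y * poisson e (x - y))).
Proof.
move=> e0 mk.
apply: (@measurable_Rintegral_snd _ _ _ _ _ mu (fun u : R * R => k u.2 * poisson e (u.1 - u.2))).
apply: measurable_funM; last exact: measurable_poissonB.
exact: measurableT_comp.
Qed.

(** Young's inequality for convolution with the Poisson kernel. The factor [pi] is independent of
    [e], so an L^1 error in [k] stays under control as [e] tends to 0. *)
Lemma poisson_int_L1 e k : 0 < e -> mu.-integrable setT (EFin \o k) ->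
  (\int[mu]_x `|(\int[mu]_y (k y * poisson e (x - y)))%:E|
   <= (pi : R)%:E * \int[mu]_y `|k y|%:E)%E.
Proof.
move=> e0 ik; have mk : measurable_fun setT k.
  by apply/measurable_EFinP; exact: measurable_int ik.
have mkp : measurable_fun setT (fun u : R * R => `|k u.2| * poisson e (u.1 - u.2)).
  apply: measurable_funM; last exact: measurable_poissonB.
  by apply: measurableT_comp => //; exact: measurableT_comp.
apply: (@le_trans _ _ (\int[mu]_x \int[mu]_y (`|k y| * poisson e (x - y))%:E)%E).
  apply: ge0_le_integral => //.
  - apply/measurable_EFinP/measurableT_comp => //; exact: measurable_poisson_int.
  - apply: (@measurable_integral_snd _ _ _ _ _ mu (fun x y : R => (`|k y| * poisson e (x - y))%:E)).
      exact/measurable_EFinP.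
    by move=> x y; rewrite lee_fin mulr_ge0// poisson_ge0.
  - move=> x _; have -> : (\int[mu]_y (k y * poisson e (x - y)))%R%:E = (\int[mu]_y (k y * poisson e (x - y))%:E)%E.
      apply/esym/Rintegral_EFin.
      (* For [k] in L^1 the product with the kernel is integrable because the kernel never exceeds 1
         / e. *)
      have iq : mu.-integrable setT (EFin \o (fun y : R => `|k y| * e^-1)).
        apply: eq_integrable (integrableZr measurableT e^-1 (integrable_norm ik)) => // y _.
      apply: (@le_Rintegrable _ _ _ mu _ _ _ _ iq).
        apply: measurable_funM => //; apply: continuous_measurable_fun.
        exact: continuous_poissonB.
      move=> y; rewrite normrM (ger0_norm (poisson_ge0 _ e0)) ler_wpM2l//.
      rewrite /poisson ler_pdivrMr ?denom_gt0//.
      have -> : e^-1 * (e ^+ 2 + (x - y) ^+ 2) = e + e^-1 * (x - y) ^+ 2 by field; rewrite gt_eqF.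
      by rewrite lerDl mulr_ge0 ?sqr_ge0// invr_ge0 ltW.
    apply: (le_trans (le_abse_integral _ _ _)) => //.
      apply/measurable_EFinP; apply: measurable_funM => //; apply: continuous_measurable_fun.
      exact: continuous_poissonB.
    by under eq_integral do rewrite /= normrM (ger0_norm (poisson_ge0 _ e0)).
rewrite (@integral_swap _ _ _ _ _ mu mu (fun x y : R => (`|k y| * poisson e (x - y))%:E))/=; last 2 first.
- exact/measurable_EFinP.
- by move=> x y; rewrite lee_fin mulr_ge0// poisson_ge0.
have pe : (0 <= (pi : R)%:E)%E by rewrite lee_fin pi_ge0.
have mkn : measurable_fun setT (fun y : R => `|k y|%:E).
  by apply/measurable_EFinP; exact: measurableT_comp.
rewrite -ge0_integralZl//.
apply: ge0_le_integral => //.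
- by move=> y _; apply: integral_ge0 => x _; rewrite lee_fin mulr_ge0// poisson_ge0.
- apply: (@measurable_integral_fst _ _ _ _ _ mu (fun x y : R => (`|k y| * poisson e (x - y))%:E)).
    exact/measurable_EFinP.
  by move=> x y; rewrite lee_fin mulr_ge0// poisson_ge0.
- by apply/measurable_EFinP; apply: measurable_funM => //; exact: measurableT_comp.
move=> y _; under eq_integral do rewrite EFinM poissonB_sym.
rewrite ge0_integralZl//.
- by rewrite integral_poisson// muleC.
- apply/measurable_EFinP; apply: continuous_measurable_fun.
  exact: continuous_poissonB.
- by move=> x _; rewrite lee_fin poisson_ge0.
Qed.

(** [cvg_poisson] requires continuity, so one of the two copies of [h] is replaced by a continuous
    [psi], for which the limit is dominated convergence. The replacement costs at most M pi |h -
    psi|_1, both in the limit and in the form, in the latter uniformly in n by [poisson_int_L1]. *)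
Lemma cvg_poisson_form M r h : bounded_cs M r h -> 0 <= r ->
  poisson_form n.+1%:R^-1 h h @[n --> \oo] --> pi * \int[mu]_x (h x ^+ 2).
Proof.
move=> hb r0; have M0 := bounded_cs_ge0 hb r0.
have hM y : `|h y| <= M by rewrite -[leRHS](ger0_norm M0) (bounded_cs_le _ hb).
have ih := bounded_cs_integrable hb; have mh : measurable_fun setT h by case: hb.
have e0 n : (0 : R) < n.+1%:R^-1 by [].
have p0 := pi_gt0 R.
have iMh (k : R -> R) K : measurable_fun setT k -> (forall y, `|k y| <= K) ->
    mu.-integrable setT (EFin \o (fun x : R => h x * k x)).
  move=> mk kK; have iq : mu.-integrable setT (EFin \o (fun y : R => `|h y| * K)).
    by apply: eq_integrable (integrableZr measurableT K (integrable_norm ih)) => // y _.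
  apply: (@le_Rintegrable _ _ _ mu _ _ _ _ iq); first exact: measurable_funM.
  by move=> y; rewrite normrM ler_wpM2l.
apply/cvgrPdist_le => d d0.
(* Makes each replacement error M pi q at most d / 3; [M + 1] in place of [M] avoids a division by
   0. *)
pose q := d / (3 * (M + 1) * pi).
have M1 : 0 < M + 1 by rewrite ltr_wpDl.
have q0 : 0 < q by rewrite divr_gt0// !mulr_gt0.
have qE : (M + 1) * pi * q = d / 3.
  have F (P : R) : 0 < P -> (M + 1) * P * (d / (3 * (M + 1) * P)) = d / 3.
    by move=> P0; field; rewrite !gt_eqF.
  exact: F.
have [psi [cpsi psiM lpsi]] := bounded_cs_continuous_approx hb r0 q0.
have mpsi : measurable_fun setT psi by exact: continuous_measurable_fun.
have ihp : mu.-integrable setT (EFin \o (fun y : R => h y - psi y)).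
  apply/integrableP; split; first by apply/measurable_EFinP; exact: measurable_funB.
  by apply: lt_trans lpsi _; rewrite ltry.
have R1 : \int[mu]_y `|h y - psi y| <= q.
  rewrite -lee_fin -Rintegral_EFin ?ltW//; exact: (integrable_norm ihp).
have vc : poisson_form n.+1%:R^-1 h psi @[n --> \oo] --> \int[mu]_x (h x * (pi * psi x)).
  apply: (@cvg_Rintegral_dominated _ _ _ mu _ _ (fun x : R => `|h x| * (M * pi))).
  - by move=> n; apply: measurable_funM => //; exact: measurable_poisson_int.
  - by apply: measurable_funM => //; exact: measurable_funM.
  - by move=> x; apply: cvgM; [exact: cvg_cst|exact: cvg_poisson].
  - by move=> n x; rewrite normrM ler_wpM2l// normr_poisson_int_le.
  - apply: eq_integrable (integrableZr measurableT (M * pi) (integrable_norm ih)) => // y _.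
have d3 : 0 < d / 3 by rewrite divr_gt0.
have vd : `|pi * \int[mu]_x (h x ^+ 2) - \int[mu]_x (h x * (pi * psi x))| <= d / 3.
  have i2 : mu.-integrable setT (EFin \o (fun x : R => h x ^+ 2)).
    by apply: eq_integrable (iMh h M mh hM) => // y _ /=; rewrite expr2.
  rewrite -RintegralZl// -RintegralB//; last 2 first.
  - exact: (integrableZl measurableT pi i2).
  - apply: (iMh (fun x : R => pi * psi x) (pi * M)); first exact: measurable_funM.
    by move=> y; rewrite normrM (gtr0_norm p0) ler_wpM2l// ltW.
  have iN := integrable_norm ihp.
  apply: le_trans (@normr_Rintegral_le _ _ _ mu _ (fun x : R => M * pi * `|h x - psi x|) _ _ _) _.
  - by apply: measurable_funB; apply: measurable_funM => //; [exact: measurable_funX|exact: measurable_funM].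
  - move=> x; have -> : pi * h x ^+ 2 - h x * (pi * psi x) = h x * pi * (h x - psi x) by ring.
    by rewrite !normrM (gtr0_norm p0) ler_wpM2r// ler_wpM2r ?hM// ltW.
  - exact: (integrableZl measurableT (M * pi) iN).
  rewrite (@RintegralZl _ _ _ mu setT (fun x : R => `|h x - psi x|))// -qE.
  apply: ler_pM => //; [by rewrite mulr_ge0// ltW|exact: Rintegral_ge0|].
  by rewrite ler_wpM2r ?ltW// ltrDl.
have ud n : `|poisson_form n.+1%:R^-1 h psi - poisson_form n.+1%:R^-1 h h| <= d / 3.
  have bP k K : measurable_fun setT k -> (forall y, `|k y| <= K) ->
      mu.-integrable setT (EFin \o (fun x : R => h x * \int[mu]_y (k y * poisson n.+1%:R^-1 (x - y)))).
    move=> mk kK; apply: (iMh _ (K * pi)); first exact: measurable_poisson_int.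
    by move=> x; exact: normr_poisson_int_le.
  rewrite /poisson_form -RintegralB//; [|exact: bP|exact: bP].
  under eq_Rintegral => x _.
    rewrite -mulrBr -RintegralB//; [|exact: integrableM_poisson|exact: integrableM_poisson].
    under eq_Rintegral do rewrite -mulrBl -opprB.
    over.
  pose g (y : R) : R := - (h y - psi y).
  have ig : mu.-integrable setT (EFin \o g) by exact: (integrableN ihp).
  have mg : measurable_fun setT g by apply/measurable_EFinP; exact: measurable_int ig.
  have gN y : `|g y| = `|h y - psi y| by rewrite normrN.
  have L1 := poisson_int_L1 (e0 n) ig.
  have lt1 : (pi%:E * \int[mu]_y `|g y|%:E <= (pi * q)%:E)%E.
    rewrite EFinM lee_pmul2l// ?lte_fin//.
    by under eq_integral do rewrite gN; exact: ltW.
  have iP : mu.-integrable setT (EFin \o (fun x : R => \int[mu]_y (g y * poisson n.+1%:R^-1 (x - y)))).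
    apply/integrableP; split; first by apply/measurable_EFinP; exact: measurable_poisson_int.
    by rewrite (le_lt_trans L1)// (le_lt_trans lt1)// ltry.
  have iPn := integrable_norm iP.
  apply: le_trans (@normr_Rintegral_le _ _ _ mu _ (fun x : R => M * `|\int[mu]_y (g y * poisson n.+1%:R^-1 (x - y))|) _ _ _) _.
  - by apply: measurable_funM => //; exact: measurable_poisson_int.
  - by move=> x; rewrite normrM ler_wpM2r.
  - exact: (integrableZl measurableT M iPn).
  rewrite (@RintegralZl _ _ _ mu setT (fun x : R => `|\int[mu]_y (g y * poisson n.+1%:R^-1 (x - y))|))// -qE -mulrA.
  apply: ler_pM => //; [exact: Rintegral_ge0|by rewrite lerDl|].
  by rewrite -lee_fin -Rintegral_EFin// (le_trans L1).
move/cvgrPdist_le : vc => /(_ _ d3); apply: filterS => n vn.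
set a := pi * _ in vd *; set b := \int[mu]_x _ in vd vn.
have -> : a - poisson_form n.+1%:R^-1 h h = (a - b) + (b - poisson_form n.+1%:R^-1 h psi) + (poisson_form n.+1%:R^-1 h psi - poisson_form n.+1%:R^-1 h h) by ring.
apply: (le_trans (ler_normD _ _)); apply: (@le_trans _ _ ((d / 3 + d / 3) + d / 3)); last by lra.
by apply: lerD => //; apply: (le_trans (ler_normD _ _)); apply: lerD.
Qed.

End PoissonForm.

(** * Plancherel on the line *)

Section PlancherelLine.
Context {R : realType}.
Local Notation mu := (@lebesgue_measure R).
Implicit Types (h A B : R -> R) (M r e xi : R).

Definition fcos1 h xi : R := \int[mu]_x (h x * cos (x * xi)).
Definition fsin1 h xi : R := \int[mu]_x (h x * sin (x * xi)).

Lemma measurable_fcos1 h : measurable_fun setT h -> measurable_fun setT (fcos1 h).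
Proof.
move=> mh; apply: (@measurable_Rintegral_snd _ _ _ _ _ mu
  (fun u : R * R => h u.2 * cos (u.2 * u.1))).
by solve_measurable.
Qed.

Lemma measurable_fsin1 h : measurable_fun setT h -> measurable_fun setT (fsin1 h).
Proof.
move=> mh; apply: (@measurable_Rintegral_snd _ _ _ _ _ mu
  (fun u : R * R => h u.2 * sin (u.2 * u.1))).
by solve_measurable.
Qed.

Lemma fcos1N h xi : fcos1 h (- xi) = fcos1 h xi.
Proof. by apply: eq_Rintegral => x _; rewrite mulrN cosN. Qed.

Lemma fsin1N M r h xi : bounded_cs M r h -> fsin1 h (- xi) = - fsin1 h xi.
Proof.
move=> hb; rewrite /fsin1; under eq_Rintegral do rewrite mulrN sinN mulrN -mulN1r.
rewrite RintegralZl ?mulN1r//; have [mh _] := hb.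
apply: (@le_Rintegrable _ _ _ mu _ _ _ _ (integrable_norm (bounded_cs_integrable hb))).
  by solve_measurable.
by move=> x; rewrite normrM ler_piMr// sin_max.
Qed.

Section real.
Variables (M r : R) (h : R -> R).
Hypotheses (hb : bounded_cs M r h) (r0 : 0 <= r).

Let mh : measurable_fun setT h. Proof. by case: hb. Qed.
Let ih : mu.-integrable setT (EFin \o h). Proof. exact: bounded_cs_integrable hb. Qed.
Let ihn := integrable_norm ih.
Let K xi := fcos1 h xi ^+ 2 + fsin1 h xi ^+ 2.
Let S := \int[mu]_x `|h x|.

Let integrableM (g : R -> R) : measurable_fun setT g -> (forall x, `|g x| <= 1) ->
  mu.-integrable setT (EFin \o (fun x : R => h x * g x)).
Proof.
move=> mg g1; apply: (@le_Rintegrable _ _ _ mu _ _ _ _ ihn); first exact: measurable_funM.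
by move=> x; rewrite normrM ler_piMr.
Qed.

Let icos (x xi : R) : mu.-integrable setT (EFin \o (fun y : R => h y * cos ((x - y) * xi))).
Proof. by apply: integrableM => [|y]; [solve_measurable|exact: cos_max]. Qed.

Let normr_inner (x xi : R) : `|\int[mu]_y (h y * cos ((x - y) * xi))| <= S.
Proof.
apply: normr_Rintegral_le => //; first by solve_measurable.
by move=> y; rewrite normrM ler_piMr// cos_max.
Qed.

Let inner (x xi : R) : cos (x * xi) * fcos1 h xi + sin (x * xi) * fsin1 h xi
  = \int[mu]_y (h y * cos ((x - y) * xi)).
Proof.
have i1 : mu.-integrable setT (EFin \o (fun y : R => h y * cos (y * xi))).
  by apply: integrableM => [|y]; [solve_measurable|exact: cos_max].
have i2 : mu.-integrable setT (EFin \o (fun y : R => h y * sin (y * xi))).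
  by apply: integrableM => [|y]; [solve_measurable|exact: sin_max].
rewrite -!RintegralZl// -RintegralD//; last 2 first.
- exact: (integrableZl measurableT _ i1).
- exact: (integrableZl measurableT _ i2).
by apply: eq_Rintegral => y _; rewrite mulrBl cosB; ring.
Qed.

(** By cos (a - b) = cos a cos b + sin a sin b the squared modulus becomes a double integral in
    which xi occurs in a single cosine, ready to be integrated against the weight. *)
Let KE xi : K xi = \int[mu]_x (h x * \int[mu]_y (h y * cos ((x - y) * xi))).
Proof.
rewrite /K; transitivity (\int[mu]_x ((h x * cos (x * xi)) * fcos1 h xi + (h x * sin (x * xi)) * fsin1 h xi)).
  have i1 : mu.-integrable setT (EFin \o (fun y : R => h y * cos (y * xi))).
    by apply: integrableM => [|y]; [solve_measurable|exact: cos_max].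
  have i2 : mu.-integrable setT (EFin \o (fun y : R => h y * sin (y * xi))).
    by apply: integrableM => [|y]; [solve_measurable|exact: sin_max].
  rewrite RintegralD//; last 2 first.
  - exact: (integrableZr measurableT _ i1).
  - exact: (integrableZr measurableT _ i2).
  by rewrite !RintegralZr// !expr2.
by apply: eq_Rintegral => x _; rewrite -inner; ring.
Qed.

Let measurable_inner : measurable_fun setT (fun u : R * R =>
  \int[mu]_y (h y * cos ((u.2 - y) * u.1))).
Proof.
apply: (@measurable_Rintegral_snd _ _ _ _ _ mu (fun v : (R * R) * R =>
  h v.2 * cos ((v.1.2 - v.2) * v.1.1))).
apply: measurable_funM; first by solve_measurable.
apply: measurable_cos; apply: measurable_funM.
  by apply: measurable_funB => //; apply: (measurableT_comp measurable_snd).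
by apply: (measurableT_comp measurable_fst).
Qed.

Let S0 : 0 <= S. Proof. exact: Rintegral_ge0. Qed.

(** Two exchanges bring the integral in xi innermost, each dominated by the weight in xi times a
    multiple of |h| in the other variable. The cosine transform of the weight is then twice the
    Poisson kernel. *)
Let weighted e : 0 < e ->
  \int[mu]_xi (exp_weight e xi * K xi) = 2 * poisson_form e h h.
Proof.
move=> e0; have ie := integrable_exp_weight e0.
have mw : measurable_fun setT (exp_weight e).
  by apply: continuous_measurable_fun; exact: continuous_exp_weight.
have w0 xi : 0 <= exp_weight e xi by exact: expR_ge0.
pose f1 (xi x : R) := exp_weight e xi * (h x * \int[mu]_y (h y * cos ((x - y) * xi))).
transitivity (\int[mu]_xi \int[mu]_x f1 xi x).
  apply: eq_Rintegral => xi _; rewrite KE /f1 RintegralZl//.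
  apply: (@le_Rintegrable _ _ _ mu _ _ _ _ (integrableZr measurableT S ihn)).
    apply: measurable_funM => //.
    apply: (@measurable_Rintegral_snd _ _ _ _ _ mu (fun v : R * R => h v.2 * cos ((v.1 - v.2) * xi))).
    by solve_measurable.
  by move=> x; rewrite normrM ler_wpM2l.
rewrite (@Rintegral_swap _ _ _ _ _ mu mu (fun u : R * R => f1 u.1 u.2) (exp_weight e) (fun x : R => `|h x| * S))//=; last 3 first.
- apply: measurable_funM; first exact: measurableT_comp.
  by apply: measurable_funM => //; exact: measurableT_comp.
- exact: (integrableZr measurableT S ihn).
- by move=> xi x; rewrite /f1 normrM (ger0_norm (w0 _)) ler_wpM2l// normrM ler_wpM2l.
rewrite /poisson_form -RintegralZl//; last first.
  apply: (@le_Rintegrable _ _ _ mu _ _ _ _ (integrableZr measurableT (`|M| * pi) ihn)).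
    by apply: measurable_funM => //; exact: measurable_poisson_int.
  move=> x; rewrite normrM ler_wpM2l// normr_poisson_int_le// => y.
  exact: bounded_cs_le hb.
apply: eq_Rintegral => x _; rewrite /f1.
transitivity (\int[mu]_xi (h x * \int[mu]_y (h y * (exp_weight e xi * cos ((x - y) * xi))))).
  apply: eq_Rintegral => xi _; rewrite mulrCA; congr (_ * _).
  rewrite -RintegralZl//; apply: eq_Rintegral => y _; ring.
have mf : measurable_fun setT (fun u : R * R => h u.2 * (exp_weight e u.1 * cos ((x - u.2) * u.1))).
  apply: measurable_funM; first exact: measurableT_comp.
  by apply: measurable_funM; [exact: measurableT_comp|solve_measurable].
have fb (xi y : R) : `|h y * (exp_weight e xi * cos ((x - y) * xi))| <= exp_weight e xi * `|h y|.
  by rewrite mulrC !normrM (ger0_norm (w0 _)) ler_wpM2r// ler_piMr// cos_max.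
rewrite RintegralZl//; last first.
  exact: (@Rintegral_snd_integrable _ _ _ _ _ mu mu (fun u : R * R => h u.2 * (exp_weight e u.1 * cos ((x - u.2) * u.1))) (exp_weight e) (fun x : R => `|h x|)).
rewrite mulrCA; congr (_ * _).
rewrite (@Rintegral_swap _ _ _ _ _ mu mu (fun u : R * R => h u.2 * (exp_weight e u.1 * cos ((x - u.2) * u.1))) (exp_weight e) (fun x : R => `|h x|))//=.
rewrite -RintegralZl//; last first.
  by apply: integrableM_poisson e0 mh _ => y; exact: bounded_cs_le hb.
apply: eq_Rintegral => y _.
rewrite RintegralZl//; last first.
  apply: (@le_Rintegrable _ _ _ mu _ _ _ _ ie); first by solve_measurable.
  by move=> xi; rewrite normrM (ger0_norm (w0 _)) ler_piMr// cos_max.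
by rewrite Rintegral_exp_weight_cos// mulrCA.
Qed.

(** As e decreases to 0 the weight increases to 1, so monotone convergence identifies the left side
    before [K] is known to be integrable, while [cvg_poisson_form] gives the limit of the right
    side. *)
Lemma plancherel1_real :
  (\int[mu]_xi (fcos1 h xi ^+ 2 + fsin1 h xi ^+ 2)%:E
   = (2 * pi * \int[mu]_x (h x ^+ 2))%:E)%E.
Proof.
have mK : measurable_fun setT K.
  by apply: measurable_funD; apply: measurable_funX; [exact: measurable_fcos1|exact: measurable_fsin1].
have K0 xi : 0 <= K xi by rewrite addr_ge0 ?sqr_ge0.
(* Boundedness of [K] makes each weighted integral finite, hence equal to the real-valued integral
   of [weighted]. *)
have KS xi : `|K xi| <= S ^+ 2.
  have mc : measurable_fun setT (fun x : R => cos (x * xi)) by solve_measurable.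
  rewrite KE; apply: le_trans (@normr_Rintegral_le _ _ _ mu _ (fun x : R => `|h x| * S) _ _ _) _.
  - apply: measurable_funM => //.
    apply: (@measurable_Rintegral_snd _ _ _ _ _ mu (fun v : R * R => h v.2 * cos ((v.1 - v.2) * xi))).
    by solve_measurable.
  - by move=> x; rewrite normrM ler_wpM2l.
  - exact: (integrableZr measurableT S ihn).
  - by rewrite RintegralZr// expr2.
have e0 n : (0 : R) < n.+1%:R^-1 by [].
have mw e : measurable_fun setT (exp_weight e).
  by apply: continuous_measurable_fun; exact: continuous_exp_weight.
have iw n : mu.-integrable setT (EFin \o (fun xi => exp_weight n.+1%:R^-1 xi * K xi)).
  apply: (@le_Rintegrable _ _ _ mu _ _ _ _ (integrableZr measurableT (S ^+ 2) (integrable_exp_weight (e0 n)))).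
    by apply: measurable_funM; [exact: mw|exact: mK].
  by move=> xi; rewrite normrM (ger0_norm (expR_ge0 _)) ler_wpM2l ?expR_ge0.
have lim1 : (\int[mu]_xi (exp_weight n.+1%:R^-1 xi * K xi)%:E @[n --> \oo] --> \int[mu]_xi (K xi)%:E)%E.
  have -> : (fun xi => (K xi)%:E) = (fun xi => limn (fun n => (exp_weight n.+1%:R^-1 xi * K xi)%:E)).
    apply/funext => xi; apply/esym/cvg_lim => //.
    apply: cvg_EFin; first exact: nearW.
    have c1 : - (n.+1%:R^-1 * `|xi|) @[n --> \oo] --> - (0 * `|xi|).
      by apply: cvgN; apply: cvgM; [exact: cvg_harmonic|exact: cvg_cst].
    have c2 : exp_weight n.+1%:R^-1 xi @[n --> \oo] --> expR (- (0 * `|xi|)).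
      by apply: (cvg_comp _ _ c1); exact: continuous_expR.
    rewrite mul0r oppr0 expR0 in c2.
    by rewrite -{2}(mul1r (K xi)); apply: cvgM; [exact: c2|exact: cvg_cst].
  apply: cvg_monotone_convergence => //.
  - by move=> n; apply/measurable_EFinP; apply: measurable_funM; [exact: mw|exact: mK].
  - by move=> n xi _; rewrite lee_fin mulr_ge0// expR_ge0.
  - move=> xi _ m n mn; rewrite lee_fin ler_wpM2r// ler_expR lerN2 ler_wpM2r//.
    by rewrite lef_pV2 ?posrE// ler_nat.
have lim2 : (\int[mu]_xi (exp_weight n.+1%:R^-1 xi * K xi)%:E @[n --> \oo] --> (2 * (pi * \int[mu]_x (h x ^+ 2)))%:E)%E.
  under eq_cvg => n do rewrite (Rintegral_EFin (iw n)) weighted//.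
  apply: cvg_EFin; first exact: nearW.
  by apply: cvgM; [exact: cvg_cst|exact: (cvg_poisson_form hb r0)].
rewrite -mulrA; exact: (cvg_unique _ lim1 lim2).
Qed.

End real.
End PlancherelLine.

(** * Plancherel on the line for complex functions *)

Section PlancherelLineComplex.
Context {R : realType}.
Local Notation mu := (@lebesgue_measure R).
Implicit Types (h A B : R -> R) (M r e xi : R).

Lemma ge0_integral_oppr (f : R -> \bar R) : measurable_fun setT f ->
  (forall x, 0 <= f x)%E -> (\int[mu]_x f (- x)%R = \int[mu]_x f x)%E.
Proof.
move=> mf f0; have mN : measurable_fun setT (-%R : R -> measurableTypeR R).
  exact: oppr_measurable.
transitivity (\int[pushforward mu (-%R : _ -> measurableTypeR R)]_x f x)%E.
  by rewrite ge0_integral_pushforward// => x _; exact: f0.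
by apply: eq_measure_integral => X mX _; exact: lebesgue_measureN.
Qed.

(* |(A + iB)^|^2, expanded into real transforms *)
Definition sqr_fourier1 A B xi : R :=
  (fcos1 A xi + fsin1 B xi) ^+ 2 + (fcos1 B xi - fsin1 A xi) ^+ 2.

(** The cross terms, such as [fcos1 A] times [fsin1 B], are odd in xi. Adding the integral to its
    image under xi -> - xi cancels them and leaves twice the sum of the real identities for [A] and
    [B]. *)
Lemma plancherel1 M r A B : bounded_cs M r A -> bounded_cs M r B -> 0 <= r ->
  (\int[mu]_xi (sqr_fourier1 A B xi)%:E
   = (2 * pi)%:E * \int[mu]_x (A x ^+ 2 + B x ^+ 2)%:E)%E.
Proof.
move=> hA hB r0; have [mA _] := hA; have [mB _] := hB.
have mcA := measurable_fcos1 mA; have msA := measurable_fsin1 mA.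
have mcB := measurable_fcos1 mB; have msB := measurable_fsin1 mB.
have isq h : bounded_cs M r h -> mu.-integrable setT (EFin \o (fun x : R => h x ^+ 2)).
  move=> hh; have [mh _] := hh.
  have ih := integrableZl measurableT `|M| (integrable_norm (bounded_cs_integrable hh)).
  apply: (@le_Rintegrable _ _ _ mu _ (fun x => `|M| * `|h x|) _ _ ih).
    exact: measurable_funX.
  by move=> x; rewrite expr2 normrM ler_wpM2r// (bounded_cs_le _ hh).
have ms : measurable_fun setT (sqr_fourier1 A B).
  apply: measurable_funD; apply: measurable_funX; first exact: measurable_funD.
  exact: measurable_funB.
have s0 xi : 0 <= sqr_fourier1 A B xi by rewrite addr_ge0 ?sqr_ge0.
have pA := plancherel1_real hA r0; have pB := plancherel1_real hB r0.
set I := (\int[mu]_xi _)%E.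
have II : (I + I = (2 * pi)%:E * \int[mu]_x (A x ^+ 2 + B x ^+ 2)%:E
    + (2 * pi)%:E * \int[mu]_x (A x ^+ 2 + B x ^+ 2)%:E)%E.
  have m1 : measurable_fun setT (fun xi => (sqr_fourier1 A B xi)%:E) by exact/measurable_EFinP.
  have m2 : measurable_fun setT (fun xi => (sqr_fourier1 A B (- xi))%:E).
    by apply/measurable_EFinP; apply: (measurableT_comp ms); exact: oppr_measurable.
  rewrite {1}/I -(@ge0_integral_oppr (fun xi => (sqr_fourier1 A B xi)%:E))//.
  have s0E xi : (0 <= (sqr_fourier1 A B xi)%:E)%E by rewrite lee_fin.
  rewrite -ge0_integralD//.
  transitivity (\int[mu]_xi (2%:E * ((fcos1 A xi ^+ 2 + fsin1 A xi ^+ 2)%:E + (fcos1 B xi ^+ 2 + fsin1 B xi ^+ 2)%:E)))%E.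
    apply: eq_integral => xi _; rewrite -!EFinD -EFinM; congr EFin.
    by rewrite /sqr_fourier1 !fcos1N (fsin1N _ hA) (fsin1N _ hB); ring.
  have mh h : measurable_fun setT (fcos1 h) -> measurable_fun setT (fsin1 h) ->
      measurable_fun setT (fun xi => (fcos1 h xi ^+ 2 + fsin1 h xi ^+ 2)%:E).
    by move=> mc ms'; apply/measurable_EFinP; apply: measurable_funD; apply: measurable_funX.
  have h0 h xi : (0 <= (fcos1 h xi ^+ 2 + fsin1 h xi ^+ 2)%:E)%E.
    by rewrite lee_fin addr_ge0 ?sqr_ge0.
  rewrite ge0_integralZl//; last 2 first.
  - by apply: emeasurable_funD; exact: mh.
  - by move=> xi _; apply: adde_ge0.
  rewrite ge0_integralD//; [|exact: mh|exact: mh].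
  rewrite pA pB.
  have -> : (\int[mu]_x (A x ^+ 2 + B x ^+ 2)%:E = (\int[mu]_x (A x ^+ 2) + \int[mu]_x (B x ^+ 2))%:E)%E.
    rewrite -RintegralD; [|by []|exact: isq|exact: isq].
    apply: Rintegral_EFin.
    have := integrableD measurableT (isq A hA) (isq B hB).
    by apply: eq_integrable.
  by rewrite -EFinD -!EFinM -EFinD; congr EFin; ring.
have I0 : (0 <= I)%E by apply: integral_ge0 => xi _; rewrite lee_fin.
have J0 : (0 <= (2 * pi)%:E * \int[mu]_x (A x ^+ 2 + B x ^+ 2)%:E)%E.
  rewrite mule_ge0//; first by rewrite lee_fin mulr_ge0// pi_ge0.
  by apply: integral_ge0 => x _; rewrite lee_fin addr_ge0 ?sqr_ge0.
(* Halving is done in the extended reals, [I] not being known to be finite beforehand. *)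
have dbl (a b : \bar R) : (0 <= a)%E -> (0 <= b)%E -> (a + a = b + b)%E -> a = b.
  by move: a b => [a| |] [b| |]//= _ _; rewrite -?EFinD => -[] // ab; congr EFin; lra.
exact: dbl I0 J0 II.
Qed.

End PlancherelLineComplex.

(** * Plancherel on R^n *)

Section LebesgueRnTheory.
Context {R : realType}.
Local Notation leb := (@lebesgue_measure R).

Lemma ge0_integral_consR n (f : n.+1.-tuple R -> \bar R) : measurable_fun setT f ->
  (forall x, 0 <= f x)%E ->
  (\int[lebesgue_Rn n.+1]_x f x = \int[leb]_a \int[lebesgue_Rn n]_b f (consR (a, b)))%E.
Proof.
move=> mf f0; rewrite /= /lebesgue_step ge0_integral_pushforward//.
- rewrite fubini_tonelli1//; first by apply: (measurableT_comp mf); exact: measurable_consR.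
  by move=> x; exact: f0.
- exact: measurable_consR.
Qed.

(** The first coordinate is integrated innermost, because it is the one transformed first. *)
Lemma Rintegral_consR n (f : n.+1.-tuple R -> R) (a : R -> R) (b : n.-tuple R -> R) :
  measurable_fun setT f ->
  leb.-integrable setT (EFin \o a) -> (lebesgue_Rn n).-integrable setT (EFin \o b) ->
  (forall x y, `|f (consR (x, y))| <= a x * b y) ->
  \int[lebesgue_Rn n.+1]_x f x = \int[lebesgue_Rn n]_y \int[leb]_x f (consR (x, y)).
Proof.
move=> mf ia ib fab.
have mf' : measurable_fun setT (fun u : R * n.-tuple R => f (consR u)).
  by apply: (measurableT_comp mf); exact: measurable_consR.
rewrite (@Rintegral_prod2 _ _ _ _ _ leb (lebesgue_Rn n) (fun u => f (consR u)) a b)//.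
rewrite /Rintegral; congr fine; rewrite /= /lebesgue_step integral_pushforward//=.
- exact: measurable_consR.
- exact/measurable_EFinP.
  rewrite preimage_setT; exact: (@dominated_prod_integrable _ _ _ _ _ leb (lebesgue_Rn n) _ a b mf' ia ib fab).
Qed.

(** Balls of the sup norm: unlike Euclidean balls they factor through [consR], as the induction on
    the dimension requires. *)
Definition boxRn n (r : R) : set (n.-tuple R) := [set x | forall i, `[- r, r]%classic (tnth x i)].
Definition boxn n (r : R) : n.-tuple R -> R := \1_(boxRn r).

Lemma measurable_boxRn n (r : R) : measurable (@boxRn n r).
Proof. by apply: (measurable_box (A := fun _ => `[- r, r]%classic)) => i; exact: measurable_itv. Qed.

Lemma lebesgue_boxRn n (r : R) : 0 <= r ->
  lebesgue_Rn n (@boxRn n r) = ((2 * r) ^+ n)%:E.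
Proof.
move=> r0; rewrite (lebesgue_Rn_box (A := fun _ => `[- r, r]%classic))//.
under eq_bigr => i _.
  rewrite lebesgue_measure_itv/= (_ : (if _ then _ else _) = (2 * r)%:E); last first.
    case: ifPn => [_|]; first by rewrite opprK mulr_natl mulr2n.
    rewrite lte_fin -leNgt => rNr; have -> : r = 0 by lra.
    by rewrite mulr0.
  over.
by rewrite prodEFin prodr_const card_ord.
Qed.

Lemma boxn_ge0 n r (x : n.-tuple R) : 0 <= boxn r x.
Proof. by rewrite /boxn indicE. Qed.

Lemma integral_boxn n (r : R) : 0 <= r ->
  (\int[lebesgue_Rn n]_x (boxn r x)%:E = ((2 * r) ^+ n)%:E)%E.
Proof.
move=> r0; rewrite /boxn integral_indic//; last exact: measurable_boxRn.
by rewrite setIT; exact: lebesgue_boxRn.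
Qed.

Lemma integrable_boxn n (M r : R) : 0 <= r ->
  (lebesgue_Rn n).-integrable setT (EFin \o (fun x => M * boxn r x)).
Proof.
move=> r0; have ib : (lebesgue_Rn n).-integrable setT (EFin \o (fun x => boxn r x)).
  apply/integrableP; split.
    by apply/measurable_EFinP; apply: measurable_indic; exact: (@measurable_boxRn n r).
  have e : (\int[lebesgue_Rn n]_x `|(boxn r x)%:E| = ((2 * r) ^+ n)%:E)%E.
    rewrite -(integral_boxn n r0); apply: eq_integral => x _.
    by rewrite gee0_abs// lee_fin; exact: boxn_ge0.
  by rewrite e; exact: ltry.
exact: (integrableZl measurableT M ib).
Qed.

Lemma tnth_consR0 n (x : R) (y : n.-tuple R) : tnth (consR (x, y)) ord0 = x.
Proof. by rewrite tnth0. Qed.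

Lemma tnth_consRS n (x : R) (y : n.-tuple R) i : tnth (consR (x, y)) (lift ord0 i) = tnth y i.
Proof. by rewrite tnthS. Qed.

Lemma boxn_consR n r (x : R) (y : n.-tuple R) :
  boxn r (consR (x, y)) = box1 r x * boxn r y.
Proof.
rewrite /boxn /box1 !indicE -natrM mulnb; congr (nat_of_bool _)%:R.
apply/idP/andP => [/set_mem h|[/set_mem h0 /set_mem h1]].
  split; apply/mem_set; first by have := h ord0; rewrite tnth_consR0.
  by move=> i; have := h (lift ord0 i); rewrite tnth_consRS.
apply/mem_set => i; case: (unliftP ord0 i) => [j|] ->.
  by rewrite tnth_consRS; exact: h1.
by rewrite tnth_consR0.
Qed.

Lemma dotRn_consR n (a c : R) (b d : n.-tuple R) :
  dotRn (consR (a, b)) (consR (c, d)) = a * c + dotRn b d.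
Proof.
rewrite /dotRn big_ord_recl !tnth_consR0; congr (_ + _).
by apply: eq_bigr => i _; rewrite !tnth_consRS.
Qed.

Lemma measurable_dotRn d (T : measurableType d) n (f g : T -> n.-tuple R) :
  measurable_fun setT f -> measurable_fun setT g ->
  measurable_fun setT (fun t => dotRn (f t) (g t)).
Proof.
move=> mf mg; apply: measurable_sum => i; apply: measurable_funM.
- exact: (measurableT_comp (@measurable_tnth _ R n i) mf).
- exact: (measurableT_comp (@measurable_tnth _ R n i) mg).
Qed.

End LebesgueRnTheory.

(** * Transforming one variable at a time *)

Section PlancherelRn.
Context {R : realType}.
Local Notation leb := (@lebesgue_measure R).

Definition bounded_csn n M r (h : n.-tuple R -> R) :=
  measurable_fun setT h /\ forall x, `|h x| <= M * boxn r x.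

Lemma bounded_csn_slice n M r (h : n.+1.-tuple R -> R) y : bounded_csn M r h ->
  bounded_cs (M * boxn r y) r (fun x => h (consR (x, y))).
Proof.
move=> [mh hM]; split.
  apply: (measurableT_comp mh).
  apply: (measurableT_comp (@measurable_consR R n)).
  exact: measurable_fun_pair.
by move=> x; apply: (le_trans (hM _)); rewrite boxn_consR; lra.
Qed.

Lemma bounded_csnN n M r (h : n.-tuple R -> R) : bounded_csn M r h ->
  bounded_csn M r (fun x => - h x).
Proof.
move=> [mh hM]; split; first exact: measurableT_comp.
by move=> x; rewrite normrN.
Qed.

(* real part of the Fourier transform of A + iB *)
Definition cos_sin_transform n (A B : n.-tuple R -> R) xi : R :=
  \int[lebesgue_Rn n]_x (A x * cos (dotRn x xi) + B x * sin (dotRn x xi)).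

(** Multiplication by - i turns A + iB into B - iA, so the imaginary part of the transform of A + iB
    is the real part of that of B - iA; one real functional serves for both. *)
Definition sqr_fourier n (A B : n.-tuple R -> R) xi : R :=
  cos_sin_transform A B xi ^+ 2 + cos_sin_transform B (fun x => - A x) xi ^+ 2.

Definition partial_transform n (A B : n.+1.-tuple R -> R) (c : R) (y : n.-tuple R) : R :=
  \int[leb]_x (A (consR (x, y)) * cos (x * c) + B (consR (x, y)) * sin (x * c)).

Lemma normr_trig_le (a b x M : R) : `|a| <= M -> `|b| <= M ->
  `|a * cos x + b * sin x| <= 2 * M.
Proof.
move=> aM bM; apply: (le_trans (ler_normD _ _)); rewrite !normrM mulr_natl mulr2n.
by apply: lerD; [apply: le_trans aM|apply: le_trans bM]; rewrite ler_piMr// ?cos_max ?sin_max.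
Qed.

Lemma measurable_partial_transform n (A B : n.+1.-tuple R -> R) :
  measurable_fun setT A -> measurable_fun setT B ->
  measurable_fun setT (fun u : R * n.-tuple R => partial_transform A B u.1 u.2).
Proof.
move=> mA mB.
apply: (@measurable_Rintegral_snd _ _ _ _ _ leb (fun v : (R * n.-tuple R) * R =>
  A (consR (v.2, v.1.2)) * cos (v.2 * v.1.1) + B (consR (v.2, v.1.2)) * sin (v.2 * v.1.1))).
have m12 : measurable_fun setT (fun v : (R * n.-tuple R) * R => v.1.2).
  by apply: (measurableT_comp measurable_snd); exact: measurable_fst.
have m11 : measurable_fun setT (fun v : (R * n.-tuple R) * R => v.2 * v.1.1).
  apply: measurable_funM => //; apply: (measurableT_comp measurable_fst); exact: measurable_fst.
have mc : measurable_fun setT (fun v : (R * n.-tuple R) * R => consR (v.2, v.1.2)).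
  by apply: (measurableT_comp (@measurable_consR R n)); exact: measurable_fun_pair.
apply: measurable_funD; apply: measurable_funM.
- exact: (measurableT_comp mA).
- exact: measurable_cos.
- exact: (measurableT_comp mB).
- exact: measurable_sin.
Qed.

(** The support box is preserved and only the bound changes, so the induction on the dimension
    varies [M] and keeps [r]. *)
Lemma bounded_csn_partial_transform n M r (A B : n.+1.-tuple R -> R) c :
  bounded_csn M r A -> bounded_csn M r B ->
  bounded_csn (2 * M * \int[leb]_x box1 r x) r (partial_transform A B c).
Proof.
move=> hA hB; have [mA AM] := hA; have [mB BM] := hB; split.
  have ms := measurable_partial_transform mA mB.
  apply: (measurableT_comp ms (g := fun y => (c, y))); exact: measurable_fun_pair.
move=> y; have i1 : leb.-integrable setT (EFin \o box1 r).
  by have := @integrable_box1 R 1 r; apply: eq_integrable => // x _ /=; rewrite mul1r.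
have [msA _] := bounded_csn_slice y hA; have [msB _] := bounded_csn_slice y hB.
have -> : 2 * M * (\int[leb]_x box1 r x) * boxn r y = \int[leb]_x ((2 * M * boxn r y) * box1 r x).
  by rewrite RintegralZl//; lra.
apply: normr_Rintegral_le.
- by apply: measurable_funD; apply: measurable_funM => //; [apply: measurable_cos|apply: measurable_sin];
    exact: mulrr_measurable.
- move=> x; have -> : 2 * M * boxn r y * box1 r x = 2 * (M * boxn r (consR (x, y))).
    by rewrite boxn_consR; lra.
  by apply: normr_trig_le; [exact: AM|exact: BM].
- exact: (integrableZl measurableT _ i1).
Qed.

(** The dot product splits off the first coordinate, and the addition formulas for cos and sin split
    the integrand accordingly. The remaining transform acts on a complex function even when B =
    0. *)
Lemma cos_sin_transform_consR n M r (A B : n.+1.-tuple R -> R) c d :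
  bounded_csn M r A -> bounded_csn M r B -> 0 <= r ->
  cos_sin_transform A B (consR (c, d)) = cos_sin_transform (partial_transform A B c) (partial_transform B (fun x => - A x) c) d.
Proof.
move=> hA hB r0; have [mA AM] := hA; have [mB BM] := hB; have hAN := bounded_csnN hA.
have mcs (f : R -> R) (x : R) : measurable_fun setT f -> measurable_fun setT (fun x : R => f x * cos (x * c))
   /\ measurable_fun setT (fun x : R => f x * sin (x * c)).
  by move=> mf; split; apply: measurable_funM => //; [apply: measurable_cos|apply: measurable_sin];
    exact: mulrr_measurable.
have itr (f g : R -> R) K : bounded_cs K r f -> bounded_cs K r g ->
    leb.-integrable setT (EFin \o (fun x : R => f x * cos (x * c) + g x * sin (x * c))).
  move=> [mf fK] [mg gK].
  apply: (@le_Rintegrable _ _ _ leb _ _ _ _ (@integrable_box1 R (2 * K) r)).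
    by apply: measurable_funD; [have [] := mcs f 0 mf|have [] := mcs g 0 mg].
  by move=> x; rewrite -mulrA; exact: normr_trig_le.
rewrite {1}/cos_sin_transform (@Rintegral_consR _ _ _ (fun x => (2 * M) * box1 r x) (fun y => 1 * boxn r y)).
- apply: eq_Rintegral => y _.
  have sA := bounded_csn_slice y hA; have sB := bounded_csn_slice y hB.
  have sAN := bounded_csn_slice y hAN.
  have i1 := itr _ _ _ sA sB; have i2 := itr _ _ _ sB sAN.
  rewrite /partial_transform -RintegralZr// -RintegralZr// -RintegralD//.
  + by apply: eq_Rintegral => x _; rewrite dotRn_consR cosD sinD; ring.
  + exact: (integrableZr measurableT (cos (dotRn y d)) i1).
  + exact: (integrableZr measurableT (sin (dotRn y d)) i2).
- have md : measurable_fun setT (fun x : n.+1.-tuple R => dotRn x (consR (c, d))).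
    by apply: measurable_dotRn => //; exact: measurable_id.
  by apply: measurable_funD; apply: measurable_funM => //; [exact: measurable_cos|exact: measurable_sin].
- exact: integrable_box1.
- exact: integrable_boxn.
- move=> x y; have -> : 2 * M * box1 r x * (1 * boxn r y) = 2 * (M * boxn r (consR (x, y))) by rewrite boxn_consR; ring.
  by apply: normr_trig_le; [exact: AM|exact: BM].
Qed.

Lemma measurable_cos_sin_transform n (A B : n.-tuple R -> R) :
  measurable_fun setT A -> measurable_fun setT B -> measurable_fun setT (cos_sin_transform A B).
Proof.
move=> mA mB; apply: (@measurable_Rintegral_snd _ _ _ _ _ (lebesgue_Rn n) (fun u : n.-tuple R * n.-tuple R =>
  A u.2 * cos (dotRn u.2 u.1) + B u.2 * sin (dotRn u.2 u.1))).
have md : measurable_fun setT (fun u : n.-tuple R * n.-tuple R => dotRn u.2 u.1).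
  exact: measurable_dotRn.
apply: measurable_funD; apply: measurable_funM.
- exact: (measurableT_comp mA).
- exact: measurable_cos.
- exact: (measurableT_comp mB).
- exact: measurable_sin.
Qed.

Lemma measurable_sqr_fourier n (A B : n.-tuple R -> R) :
  measurable_fun setT A -> measurable_fun setT B -> measurable_fun setT (sqr_fourier A B).
Proof.
move=> mA mB; apply: measurable_funD; apply: measurable_funX; apply: measurable_cos_sin_transform => //.
exact: measurableT_comp.
Qed.

Lemma sqr_fourier_ge0 n (A B : n.-tuple R -> R) xi : 0 <= sqr_fourier A B xi.
Proof. by rewrite addr_ge0 ?sqr_ge0. Qed.

End PlancherelRn.

(** * The induction on the dimension *)

Section PlancherelRnProof.
Context {R : realType}.
Local Notation leb := (@lebesgue_measure R).

Let mcs (f : R -> R) c : measurable_fun setT f ->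
  measurable_fun setT (fun x : R => f x * cos (x * c)) /\
  measurable_fun setT (fun x : R => f x * sin (x * c)).
Proof.
by move=> mf; split; apply: measurable_funM => //; [apply: measurable_cos|apply: measurable_sin];
  exact: mulrr_measurable.
Qed.

Lemma integrable_cos1 K r (f : R -> R) c : bounded_cs K r f ->
  leb.-integrable setT (EFin \o (fun x : R => f x * cos (x * c))).
Proof.
move=> [mf fK]; apply: (@le_Rintegrable _ _ _ leb _ _ _ _ (@integrable_box1 R K r)).
  by have [] := mcs c mf.
by move=> x; rewrite normrM; apply: le_trans (fK x); rewrite ler_piMr// cos_max.
Qed.

Lemma integrable_sin1 K r (f : R -> R) c : bounded_cs K r f ->
  leb.-integrable setT (EFin \o (fun x : R => f x * sin (x * c))).
Proof.
move=> [mf fK]; apply: (@le_Rintegrable _ _ _ leb _ _ _ _ (@integrable_box1 R K r)).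
  by have [] := mcs c mf.
by move=> x; rewrite normrM; apply: le_trans (fK x); rewrite ler_piMr// sin_max.
Qed.

Lemma partial_transformE n M r (A B : n.+1.-tuple R -> R) c y :
  bounded_csn M r A -> bounded_csn M r B ->
  partial_transform A B c y = fcos1 (fun x => A (consR (x, y))) c + fsin1 (fun x => B (consR (x, y))) c.
Proof.
move=> hA hB; rewrite /partial_transform RintegralD//.
- exact: integrable_cos1 (bounded_csn_slice y hA).
- exact: integrable_sin1 (bounded_csn_slice y hB).
Qed.

Lemma Rintegral_opp (f : R -> R) : leb.-integrable setT (EFin \o f) ->
  \int[leb]_x (- f x) = - \int[leb]_x f x.
Proof. by move=> fi; under eq_Rintegral do rewrite -mulN1r; rewrite RintegralZl ?mulN1r. Qed.

(** The second square needs the splitting for the pair (B, - A), which produces the partial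
    transform of (- A, - B); taking the sign out of the integral matches it with [sqr_fourier]. *)
Lemma sqr_fourier_consR n M r (A B : n.+1.-tuple R -> R) c d :
  bounded_csn M r A -> bounded_csn M r B -> 0 <= r ->
  sqr_fourier A B (consR (c, d)) = sqr_fourier (partial_transform A B c) (partial_transform B (fun x => - A x) c) d.
Proof.
move=> hA hB r0; have hAN := bounded_csnN hA; have hBN := bounded_csnN hB.
rewrite /sqr_fourier (cos_sin_transform_consR c d hA hB r0) (cos_sin_transform_consR c d hB hAN r0).
congr (_ + cos_sin_transform _ _ _ ^+ 2); apply/funext => y.
rewrite (partial_transformE c y hAN hBN) (partial_transformE c y hA hB) /fcos1 /fsin1 opprD.
rewrite -!Rintegral_opp; last 2 first.
- exact: integrable_sin1 (bounded_csn_slice y hB).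
- exact: integrable_cos1 (bounded_csn_slice y hA).
by congr (_ + _); apply: eq_Rintegral => x _; rewrite mulNr.
Qed.

Lemma sqr_fourier1_partial_transform n M r (A B : n.+1.-tuple R -> R) c y :
  bounded_csn M r A -> bounded_csn M r B ->
  partial_transform A B c y ^+ 2 + partial_transform B (fun x => - A x) c y ^+ 2 =
  sqr_fourier1 (fun x => A (consR (x, y))) (fun x => B (consR (x, y))) c.
Proof.
move=> hA hB; have hAN := bounded_csnN hA.
rewrite (partial_transformE c y hA hB) (partial_transformE c y hB hAN) /sqr_fourier1.
congr (_ + (_ + _) ^+ 2); rewrite /fsin1 -Rintegral_opp.
  by apply: eq_Rintegral => x _; rewrite mulNr.
exact: integrable_sin1 (bounded_csn_slice y hA).
Qed.

(** For a fixed first frequency c the induction hypothesis trades the other frequencies for the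
    variables y. After c and y are exchanged, [plancherel1] on each slice trades c for the first
    variable. *)
Lemma plancherel n M r (A B : n.-tuple R -> R) :
  bounded_csn M r A -> bounded_csn M r B -> 0 <= r ->
  (\int[lebesgue_Rn n]_xi (sqr_fourier A B xi)%:E
   = ((2 * pi) ^+ n)%:E * \int[lebesgue_Rn n]_x (A x ^+ 2 + B x ^+ 2)%:E)%E.
Proof.
elim: n M A B => [|n IH] M A B hA hB r0.
  (* R^0 is one point of mass 1, where the transform is evaluation. *)
  rewrite expr0 mul1e.
  have [mA _] := hA; have [mB _] := hB.
  have c0 (f g : 0.-tuple R -> R) xi : measurable_fun setT f -> measurable_fun setT g -> cos_sin_transform f g xi = f [tuple].
    move=> mf mg; rewrite /cos_sin_transform /Rintegral /= integral_dirac//.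
      by rewrite diracE mem_set// mul1e /= /dotRn big_ord0 cos0 sin0 mulr1 mulr0 addr0.
    apply/measurable_EFinP.
    by under eq_fun do rewrite /dotRn big_ord0 cos0 sin0 mulr1 mulr0 addr0.
  apply: eq_integral => x _; rewrite /sqr_fourier !c0//; last exact: measurableT_comp.
  by rewrite (tuple0 x).
have [mA _] := hA; have [mB _] := hB.
have hAN := bounded_csnN hA.
have mAN : measurable_fun setT (fun x => - A x) by case: hAN.
rewrite ge0_integral_consR//; last 2 first.
- by apply/measurable_EFinP; exact: measurable_sqr_fourier.
- by move=> x; rewrite lee_fin sqr_fourier_ge0.
pose M' := 2 * M * \int[leb]_x box1 r x.
transitivity (\int[leb]_c (((2 * pi) ^+ n)%:E * \int[lebesgue_Rn n]_y
    (partial_transform A B c y ^+ 2 + partial_transform B (fun x => - A x) c y ^+ 2)%:E))%E.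
  apply: eq_integral => c _; rewrite -(IH M')//.
  - by apply: eq_integral => d _; rewrite (sqr_fourier_consR c d hA hB r0).
  - exact: bounded_csn_partial_transform.
  - exact: bounded_csn_partial_transform.
have pn0 k : (0 <= ((2 * pi) ^+ k : R)%:E)%E by rewrite lee_fin exprn_ge0// mulr_ge0// pi_ge0.
have msl : measurable_fun setT (fun u : R * n.-tuple R =>
    (partial_transform A B u.1 u.2 ^+ 2 + partial_transform B (fun x => - A x) u.1 u.2 ^+ 2)%:E).
  apply/measurable_EFinP; apply: measurable_funD; apply: measurable_funX; exact: measurable_partial_transform.
have sl0 c y : (0 <= (partial_transform A B c y ^+ 2 + partial_transform B (fun x => - A x) c y ^+ 2)%:E)%E.
  by rewrite lee_fin addr_ge0 ?sqr_ge0.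
rewrite ge0_integralZl//; last 2 first.
- exact: (@measurable_integral_snd _ _ _ _ _ (lebesgue_Rn n) (fun c y =>
    (partial_transform A B c y ^+ 2 + partial_transform B (fun x => - A x) c y ^+ 2)%:E)).
- by move=> c _; exact: integral_ge0.
rewrite (@integral_swap _ _ _ _ _ leb (lebesgue_Rn n) (fun c y =>
    (partial_transform A B c y ^+ 2 + partial_transform B (fun x => - A x) c y ^+ 2)%:E))//.
rewrite exprSr EFinM -muleA; congr (_ * _)%E.
have mAB : measurable_fun setT (fun x => (A x ^+ 2 + B x ^+ 2)%:E).
  by apply/measurable_EFinP; apply: measurable_funD; exact: measurable_funX.
have mABc : measurable_fun setT (fun u : R * n.-tuple R => (A (consR (u.1, u.2)) ^+ 2 + B (consR (u.1, u.2)) ^+ 2)%:E).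
  apply: (measurableT_comp mAB (g := fun u : R * n.-tuple R => consR (u.1, u.2))).
  by apply: (measurableT_comp (@measurable_consR R n)); exact: measurable_fun_pair.
have AB0 c y : (0 <= (A (consR (c, y)) ^+ 2 + B (consR (c, y)) ^+ 2)%:E)%E.
  by rewrite lee_fin addr_ge0 ?sqr_ge0.
rewrite [in RHS]ge0_integral_consR//; last by move=> x; rewrite lee_fin addr_ge0 ?sqr_ge0.
rewrite (@integral_swap _ _ _ _ _ leb (lebesgue_Rn n) (fun c y =>
    (A (consR (c, y)) ^+ 2 + B (consR (c, y)) ^+ 2)%:E))//.
have p1 : (0 <= ((2 * pi) : R)%:E)%E by have := pn0 1; rewrite expr1.
rewrite -ge0_integralZl//; last 2 first.
- exact: (@measurable_integral_fst _ _ _ _ _ leb (fun c y =>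
    (A (consR (c, y)) ^+ 2 + B (consR (c, y)) ^+ 2)%:E)).
- by move=> y _; exact: integral_ge0.
apply: eq_integral => y _.
under eq_integral do rewrite (sqr_fourier1_partial_transform _ _ hA hB).
by rewrite (plancherel1 (bounded_csn_slice y hA) (bounded_csn_slice y hB) r0).
Qed.

End PlancherelRnProof.

(** * Plancherel in L^2 *)

Section L2truncation.
Context d (T : measurableType d) (R : realType).
Variable m : {measure set T -> \bar R}.
Local Open Scope ereal_scope.

Lemma lee_addcvg0 (X Y : \bar R) (u : nat -> \bar R) :
  u @ \oo --> 0 -> (forall k, X <= Y + u k) -> X <= Y.
Proof.
move=> u0 h; have [->|Ny] := eqVneq Y +oo; first by rewrite leey.
have c : Y + u k @[k --> \oo] --> Y + 0.
  by apply: cvgeD => //; [rewrite fin_num_adde_defl|exact: cvg_cst].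
by rewrite adde0 in c; apply: (cvge_to_ge c); exact: nearW.
Qed.

(** Fatou's lemma, the lower limit being a limit here. *)
Lemma ge0_integral_cvg_le (f_ : nat -> T -> \bar R) (f : T -> \bar R) (C : \bar R) :
  (forall n, measurable_fun setT (f_ n)) -> (forall n x, 0 <= f_ n x) ->
  (forall x, f_ ^~ x @ \oo --> f x) -> (forall n, \int[m]_x f_ n x <= C) ->
  \int[m]_x f x <= C.
Proof.
move=> mf f0 fc fC.
have -> : \int[m]_x f x = \int[m]_x limn_einf (f_ ^~ x).
  by apply: eq_integral => x _; have [-> _] := cvg_limn_einf_sup (fc x).
apply: (le_trans (fatou _ _ _ _)) => //.
rewrite limn_einf_lim; apply: lime_le; first exact: is_cvg_einfs.
by apply: nearW => n; apply: le_trans (fC n); apply: ereal_inf_lbound; exists n => /=.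
Qed.

Lemma cvg_integral_sqr_trunc (f : T -> R) (S : nat -> set T) :
  measurable_fun setT f -> \int[m]_x (f x ^+ 2)%:E < +oo ->
  (forall k, measurable (S k)) -> (forall x, \forall k \near \oo, S k x) ->
  \int[m]_x ((f x - f x * \1_(S k) x) ^+ 2)%:E @[k --> \oo] --> 0.
Proof.
move=> mf f2 mS Sx.
have [] := @dominated_convergence _ _ _ m setT measurableT
    (fun k x => ((f x - f x * \1_(S k) x) ^+ 2)%:E) (cst 0) (fun x => (f x ^+ 2)%:E).
- move=> k; apply/measurable_EFinP; apply: measurable_funX; apply: measurable_funB => //.
  by apply: measurable_funM => //; exact: measurable_indic.
- exact: measurable_cst.
- apply: aeW => x _; apply: cvg_near_cst; near=> k.
  by rewrite indicE mem_set ?mulr1 ?subrr ?expr0n//; near: k; exact: Sx.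
- apply/integrableP; split; first by apply/measurable_EFinP; exact: measurable_funX.
  by under eq_integral do rewrite gee0_abs ?lee_fin ?sqr_ge0//.
- apply: aeW => x k _; rewrite gee0_abs ?lee_fin ?sqr_ge0// indicE.
  by case: (x \in S k); rewrite ?mulr1 ?subrr ?expr0n ?sqr_ge0 ?mulr0 ?subr0.
by move=> _ _; rewrite integral_cst// mul0e.
Unshelve. all: by end_near. Qed.

(** Pythagoras: the two pieces have disjoint supports. *)
Lemma integral_sqr_trunc (f : T -> R) (S : set T) :
  measurable_fun setT f -> measurable S ->
  \int[m]_x (f x ^+ 2)%:E =
  \int[m]_x ((f x * \1_S x) ^+ 2)%:E + \int[m]_x ((f x - f x * \1_S x) ^+ 2)%:E.
Proof.
move=> mf mS; have mfS : measurable_fun setT (fun x => (f x * \1_S x)%R).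
  by apply: measurable_funM => //; exact: measurable_indic.
rewrite -ge0_integralD//.
- apply: eq_integral => x _; rewrite -EFinD; congr EFin; rewrite indicE.
  by case: (x \in S); rewrite ?mulr1 ?subrr ?expr0n ?mulr0 ?subr0 ?addr0 ?add0r ?expr0n ?add0r.
- by move=> x _; rewrite lee_fin sqr_ge0.
- by apply/measurable_EFinP; exact: measurable_funX.
- by move=> x _; rewrite lee_fin sqr_ge0.
- by apply/measurable_EFinP; apply: measurable_funX; exact: measurable_funB.
Qed.

End L2truncation.

Section PlancherelL2.
Context {R : realType} {n : nat}.
Local Notation mu := (@lebesgue_Rn R n).
Implicit Types h : n.-tuple R -> R.

Definition sqr_transform h (xi : n.-tuple R) : R :=
  (\int[mu]_x (h x * cos (dotRn x xi))) ^+ 2 + (\int[mu]_x (h x * sin (dotRn x xi))) ^+ 2.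

Lemma sqr_transform_ge0 h xi : 0 <= sqr_transform h xi.
Proof. by rewrite addr_ge0 ?sqr_ge0. Qed.

Lemma measurable_dotRn_fst (xi : n.-tuple R) : measurable_fun setT (fun x => dotRn x xi).
Proof. by apply: measurable_dotRn => //; exact: measurable_id. Qed.

Lemma measurable_Mcos h xi : measurable_fun setT h -> measurable_fun setT (fun x => h x * cos (dotRn x xi)).
Proof. by move=> mh; apply: measurable_funM => //; apply: measurable_cos; exact: measurable_dotRn_fst. Qed.

Lemma measurable_Msin h xi : measurable_fun setT h -> measurable_fun setT (fun x => h x * sin (dotRn x xi)).
Proof. by move=> mh; apply: measurable_funM => //; apply: measurable_sin; exact: measurable_dotRn_fst. Qed.

Lemma normrMcos_le h (x xi : n.-tuple R) : `|h x * cos (dotRn x xi)| <= `|h x|.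
Proof. by rewrite normrM ler_piMr// cos_max. Qed.

Lemma normrMsin_le h (x xi : n.-tuple R) : `|h x * sin (dotRn x xi)| <= `|h x|.
Proof. by rewrite normrM ler_piMr// sin_max. Qed.

Lemma integrable_Mcos h xi : mu.-integrable setT (EFin \o h) ->
  mu.-integrable setT (EFin \o (fun x => h x * cos (dotRn x xi))).
Proof.
move=> ih; have mh : measurable_fun setT h by apply/measurable_EFinP; exact: measurable_int ih.
apply: (@le_Rintegrable _ _ _ mu _ _ _ _ (integrable_norm ih)); first exact: measurable_Mcos.
by move=> x; exact: normrMcos_le.
Qed.

Lemma integrable_Msin h xi : mu.-integrable setT (EFin \o h) ->
  mu.-integrable setT (EFin \o (fun x => h x * sin (dotRn x xi))).
Proof.
move=> ih; have mh : measurable_fun setT h by apply/measurable_EFinP; exact: measurable_int ih.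
apply: (@le_Rintegrable _ _ _ mu _ _ _ _ (integrable_norm ih)); first exact: measurable_Msin.
by move=> x; exact: normrMsin_le.
Qed.

Lemma measurable_sqr_transform h : measurable_fun setT h ->
  measurable_fun setT (sqr_transform h).
Proof.
move=> mh; have md : measurable_fun setT (fun u : n.-tuple R * n.-tuple R => dotRn u.2 u.1).
  exact: measurable_dotRn.
apply: measurable_funD; apply: measurable_funX.
- apply: (@measurable_Rintegral_snd _ _ _ _ _ mu (fun u : n.-tuple R * n.-tuple R => h u.2 * cos (dotRn u.2 u.1))).
  by apply: measurable_funM; [exact: (measurableT_comp mh)|exact: measurable_cos].
- apply: (@measurable_Rintegral_snd _ _ _ _ _ mu (fun u : n.-tuple R * n.-tuple R => h u.2 * sin (dotRn u.2 u.1))).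
  by apply: measurable_funM; [exact: (measurableT_comp mh)|exact: measurable_sin].
Qed.

Lemma sqr_transform_le h xi : mu.-integrable setT (EFin \o h) ->
  sqr_transform h xi <= 2 * (\int[mu]_x `|h x|) ^+ 2.
Proof.
move=> ih; have mh : measurable_fun setT h by apply/measurable_EFinP; exact: measurable_int ih.
have ihn := integrable_norm ih.
rewrite mulr_natl mulr2n; apply: lerD; rewrite -(real_normK (num_real (\int[mu]_x (h x * _)))).
- rewrite lerXn2r ?nnegrE ?Rintegral_ge0//; apply: normr_Rintegral_le => //.
    exact: measurable_Mcos.
  by move=> x; exact: normrMcos_le.
- rewrite lerXn2r ?nnegrE ?Rintegral_ge0//; apply: normr_Rintegral_le => //.
    exact: measurable_Msin.
  by move=> x; exact: normrMsin_le.
Qed.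

(** The right side minus the left side is the squared modulus of twice the transform of [h] minus
    that of [k]. *)
Lemma sqr_transformB_le h (k : n.-tuple R -> R) xi : mu.-integrable setT (EFin \o h) -> mu.-integrable setT (EFin \o k) ->
  sqr_transform k xi <= 2 * sqr_transform h xi + 2 * sqr_transform (fun x => h x - k x) xi.
Proof.
move=> ih ik; rewrite /sqr_transform.
under [X in _ <= _ + 2 * (X ^+ 2 + _)]eq_Rintegral do rewrite mulrBl.
under [X in _ <= _ + 2 * (_ + X ^+ 2)]eq_Rintegral do rewrite mulrBl.
rewrite RintegralB//; [|exact: integrable_Mcos|exact: integrable_Mcos].
rewrite RintegralB//; [|exact: integrable_Msin|exact: integrable_Msin].
set a := \int[mu]_x _; set b := \int[mu]_x _; set c := \int[mu]_x _; set e := \int[mu]_x _.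
have h1 : 0 <= (2 * c - a) ^+ 2 by exact: sqr_ge0.
have h2 : 0 <= (2 * e - b) ^+ 2 by exact: sqr_ge0.
rewrite -subr_ge0 (_ : _ - _ = (2 * c - a) ^+ 2 + (2 * e - b) ^+ 2); last by ring.
exact: addr_ge0.
Qed.

Lemma plancherel_cs M r h : bounded_csn M r h -> 0 <= r ->
  (\int[mu]_xi (sqr_transform h xi)%:E = ((2 * pi) ^+ n)%:E * \int[mu]_x (h x ^+ 2)%:E)%E.
Proof.
move=> hb r0; have [mh hM] := hb.
have ih : mu.-integrable setT (EFin \o h).
  by apply: (@le_Rintegrable _ _ _ mu _ _ mh hM (integrable_boxn n M r0)).
have M0 : bounded_csn M r (fun _ : n.-tuple R => 0).
  by split; [exact: measurable_cst|move=> x; rewrite normr0 (le_trans _ (hM x))].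
have := plancherel hb M0 r0.
rewrite (_ : (fun x => (h x ^+ 2 + 0 ^+ 2)%:E) = (fun x => (h x ^+ 2)%:E)); last first.
  by apply/funext => x; rewrite expr0n/= addr0.
move=> <-; apply: eq_integral => xi _; congr EFin.
rewrite /sqr_transform /sqr_fourier /cos_sin_transform; congr (_ ^+ 2 + _).
  by apply: eq_Rintegral => x _; rewrite mul0r addr0.
under [in RHS]eq_Rintegral do rewrite mul0r add0r mulNr -mulN1r.
by rewrite RintegralZl ?mulN1r ?sqrrN//; exact: integrable_Msin.
Qed.

(** Cut in height as well as in space, because an integrable [h] may be unbounded; the box fits
    [bounded_csn]. *)
Let truncset h (k : nat) : set (n.-tuple R) := [set x | `|h x| <= k%:R] `&` boxRn k%:R.

Let measurable_truncset h k : measurable_fun setT h -> measurable (truncset h k).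
Proof.
move=> mh; apply: measurableI; last exact: measurable_boxRn.
rewrite (_ : [set x | _] = (fun x => `|h x|) @^-1` `]-oo, k%:R]); last first.
  by apply/seteqP; split => x /=; rewrite in_itv/=.
have mn : measurable_fun setT (fun x => `|h x|) by exact: measurableT_comp.
by rewrite -[X in measurable X]setTI; apply: mn => //; exact: measurable_itv.
Qed.

Let truncset_near h x : \forall k \near \oo, truncset h k x.
Proof.
near=> k; split => /=.
  by near: k; exact: nbhs_infty_ger.
move=> i /=; rewrite in_itv/= -ler_norml.
apply: (@le_trans _ _ (\sum_(j < n) `|tnth x j|)).
  by rewrite (bigD1 i)//= lerDl sumr_ge0.
by near: k; exact: nbhs_infty_ger.
Unshelve. all: by end_near. Qed.

Let trunc_csn h (k : nat) : measurable_fun setT h ->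
  bounded_csn k%:R k%:R (fun x => h x * \1_(truncset h k) x).
Proof.
move=> mh; split.
  by apply: measurable_funM => //; apply: measurable_indic; exact: measurable_truncset.
move=> x; rewrite /boxn !indicE; have [/set_mem[hx bx]|_] := boolP (x \in truncset h k).
  by rewrite (mem_set bx) !mulr1.
by rewrite mulr0 normr0.
Qed.

Let trunc_norm h k x : `|h x * \1_(truncset h k) x| <= `|h x|.
Proof. by rewrite normrM ler_piMr// indicE; case: (_ \in _); rewrite ?normr1 ?normr0. Qed.

Let P0 : (0 <= ((2 * pi) ^+ n : R)%:E)%E.
Proof. by rewrite lee_fin exprn_ge0// mulr_ge0// pi_ge0. Qed.

(** Since [h] is in L^1, the transforms of its truncations converge at every frequency by dominated
    convergence, and Fatou's lemma passes the equality for truncations to an inequality for [h]. *)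
Lemma plancherel_le h : mu.-integrable setT (EFin \o h) ->
  (\int[mu]_xi (sqr_transform h xi)%:E <= ((2 * pi) ^+ n)%:E * \int[mu]_x (h x ^+ 2)%:E)%E.
Proof.
move=> ih; have mh : measurable_fun setT h by apply/measurable_EFinP; exact: measurable_int ih.
have ihn := integrable_norm ih.
pose hk (k : nat) x := h x * \1_(truncset h k) x.
have mhk k : measurable_fun setT (hk k) by have [] := trunc_csn k mh.
have hkc x : hk k x @[k --> \oo] --> h x.
  apply: cvg_near_cst; near=> k; rewrite /hk indicE mem_set ?mulr1//.
  by near: k; exact: truncset_near.
apply: (@ge0_integral_cvg_le _ _ _ _ (fun k xi => (sqr_transform (hk k) xi)%:E)).
- by move=> k; apply/measurable_EFinP; exact: measurable_sqr_transform.
- by move=> k xi; rewrite lee_fin sqr_transform_ge0.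
- move=> xi; apply: cvg_EFin; first exact: nearW.
  have cc : \int[mu]_x (hk k x * cos (dotRn x xi)) @[k --> \oo] --> \int[mu]_x (h x * cos (dotRn x xi)).
    apply: (@cvg_Rintegral_dominated _ _ _ _ _ _ (fun x => `|h x|)) => //.
    + by move=> k; exact: measurable_Mcos.
    + exact: measurable_Mcos.
    + by move=> x; apply: cvgM; [exact: hkc|exact: cvg_cst].
    + by move=> k x; apply: (le_trans (normrMcos_le _ _ _)); exact: trunc_norm.
  have cs : \int[mu]_x (hk k x * sin (dotRn x xi)) @[k --> \oo] --> \int[mu]_x (h x * sin (dotRn x xi)).
    apply: (@cvg_Rintegral_dominated _ _ _ _ _ _ (fun x => `|h x|)) => //.
    + by move=> k; exact: measurable_Msin.
    + exact: measurable_Msin.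
    + by move=> x; apply: cvgM; [exact: hkc|exact: cvg_cst].
    + by move=> k x; apply: (le_trans (normrMsin_le _ _ _)); exact: trunc_norm.
  by apply: cvgD; [exact: (cvgM cc cc)|exact: (cvgM cs cs)].
- move=> k; rewrite (plancherel_cs (trunc_csn k mh))// lee_wpmul2l//.
  apply: ge0_le_integral => //.
  + by move=> x _; rewrite lee_fin sqr_ge0.
  + by apply/measurable_EFinP; apply: measurable_funX; exact: (mhk k).
  + by apply/measurable_EFinP; exact: measurable_funX.
  + move=> x _; rewrite lee_fin -[leLHS](real_normK (num_real _)) -[leRHS](real_normK (num_real _)).
    by rewrite lerXn2r ?nnegrE//; exact: trunc_norm.
Unshelve. all: by end_near. Qed.

(** The factor 2 is lost to [sqr_transformB_le], which compares the transform of a truncation with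
    that of [h]; the transform of the remainder is controlled by [plancherel_le]. Finiteness of the
    L^2 norm makes the remainder vanish in the limit. *)
Lemma plancherel_ge h : mu.-integrable setT (EFin \o h) -> (\int[mu]_x (h x ^+ 2)%:E < +oo)%E ->
  (((2 * pi) ^+ n)%:E * \int[mu]_x (h x ^+ 2)%:E <= 2%:E * \int[mu]_xi (sqr_transform h xi)%:E)%E.
Proof.
move=> ih h2; have mh : measurable_fun setT h by apply/measurable_EFinP; exact: measurable_int ih.
have mS k := measurable_truncset k mh.
have c0 := cvg_integral_sqr_trunc mh h2 mS (truncset_near h).
have sq0 (f : n.-tuple R -> R) : (0 <= \int[mu]_x (f x ^+ 2)%:E)%E.
  by apply: integral_ge0 => x _; rewrite lee_fin sqr_ge0.
pose P : \bar R := ((2 * pi) ^+ n : R)%:E.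
(* Of the 3 copies of the remainder, 1 comes from splitting the integral of h^2 and 2 from the
   transform of the remainder. *)
have c3 : (3%:E * P * \int[mu]_x ((h x - h x * \1_(truncset h k) x) ^+ 2)%:E @[k --> \oo] --> 0)%E.
  by rewrite -(mule0 (3%:E * P)%E); apply: cvgeZl.
apply: (lee_addcvg0 c3) => k.
have [mk kM] := trunc_csn k mh.
have ik : mu.-integrable setT (EFin \o (fun x => h x * \1_(truncset h k) x)).
  exact: (@le_Rintegrable _ _ _ mu _ _ mk kM (integrable_boxn n _ _)).
have ihk : mu.-integrable setT (EFin \o (fun x => h x - h x * \1_(truncset h k) x)).
  by have := integrableB measurableT ih ik; apply: eq_integrable.
rewrite (integral_sqr_trunc _ mh (mS k)) ge0_muleDr//.
rewrite -(plancherel_cs (trunc_csn k mh))//.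
have st0 (f : n.-tuple R -> R) : (0 <= \int[mu]_xi (sqr_transform f xi)%:E)%E.
  by apply: integral_ge0 => x _; rewrite lee_fin sqr_transform_ge0.
have mst (f : n.-tuple R -> R) : mu.-integrable setT (EFin \o f) -> measurable_fun setT (fun xi => (sqr_transform f xi)%:E).
  by move=> i; apply/measurable_EFinP; apply: measurable_sqr_transform; apply/measurable_EFinP; exact: measurable_int i.
have le1 : (\int[mu]_xi (sqr_transform (fun x => h x * \1_(truncset h k) x) xi)%:E <=
    2%:E * \int[mu]_xi (sqr_transform h xi)%:E +
    2%:E * (P * \int[mu]_x ((h x - h x * \1_(truncset h k) x) ^+ 2)%:E))%E.
  apply: (@le_trans _ _ (2%:E * \int[mu]_xi (sqr_transform h xi)%:E +
      2%:E * \int[mu]_xi (sqr_transform (fun x => h x - h x * \1_(truncset h k) x) xi)%:E)%E); last first.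
    by rewrite leeD2l// lee_wpmul2l//; exact: plancherel_le.
  rewrite -!ge0_integralZl//; [|exact: mst|by move=> x _; rewrite lee_fin sqr_transform_ge0
    |exact: mst|by move=> x _; rewrite lee_fin sqr_transform_ge0].
  rewrite -ge0_integralD//; last 4 first.
  - by move=> x _; rewrite mule_ge0// lee_fin sqr_transform_ge0.
  - by apply: measurable_funeM; exact: mst.
  - by move=> x _; rewrite mule_ge0// lee_fin sqr_transform_ge0.
  - by apply: measurable_funeM; exact: mst.
  apply: ge0_le_integral => //.
  - by move=> x _; rewrite lee_fin sqr_transform_ge0.
  - exact: mst.
  - by apply: emeasurable_funD; apply: measurable_funeM; exact: mst.
  - by move=> xi _; rewrite -!EFinM -EFinD lee_fin; exact: sqr_transformB_le.
apply: (le_trans (leeD2r _ le1)); rewrite -addeA leeD2l//.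
rewrite -muleA -[X in (_ + X)%E]mul1e -ge0_muleDl//.
have -> : (2%:E + 1%:E = 3%:E :> \bar R)%E by rewrite -EFinD; congr EFin; ring.
by [].
Qed.

End PlancherelL2.

(** * The Nash inequality *)

Section Nash.
Context {R : realType} {n : nat}.
Local Notation V := (n.-tuple R).
Local Notation mu := (@lebesgue_Rn R n).
Implicit Types (f g : V -> R) (F : V -> R[i]).

Definition sqrc (z : R[i]) : R := complex.Re z ^+ 2 + complex.Im z ^+ 2.

Lemma normc_sqr (z : R[i]) : Normc.normc z ^+ 2 = sqrc z.
Proof. by case: z => a b; rewrite /sqrc /= sqr_sqrtr// addr_ge0 ?sqr_ge0. Qed.

Lemma sqrc_ge0 z : 0 <= sqrc z. Proof. by rewrite addr_ge0 ?sqr_ge0. Qed.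

Lemma sqrc_fourier f xi : sqrc (fourier f xi) = sqr_transform f xi.
Proof. by rewrite /sqrc /sqr_transform /= sqrrN. Qed.

Lemma sqrc_le_sub z w : sqrc z <= 2 * sqrc (z - w) + 2 * sqrc w.
Proof.
case: z w => [a b] [c e]; rewrite /sqrc /=.
have h1 : 0 <= (2 * c - a) ^+ 2 by exact: sqr_ge0.
have h2 : 0 <= (2 * e - b) ^+ 2 by exact: sqr_ge0.
rewrite -subr_ge0 (_ : _ - _ = (2 * c - a) ^+ 2 + (2 * e - b) ^+ 2); last by ring.
exact: addr_ge0.
Qed.

Lemma sqrc_sub z w : sqrc (z - w) = sqrc (w - z).
Proof. by case: z w => [a b] [c e]; rewrite /sqrc /=; ring. Qed.

Lemma sqrc_real_mul (a : R) z : sqrc (Complex a 0 * z) = a ^+ 2 * sqrc z.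
Proof. by case: z => b c; rewrite /sqrc /=; ring. Qed.

Lemma L2_sqr_lty f : L2 f -> measurable_fun setT f /\ (\int[mu]_x (f x ^+ 2)%:E < +oo)%E.
Proof.
move=> hf; split.
  by have := sub_Lfun_mfun hf; rewrite inE.
have := Lfun2_integrable_sqr hf => /integrableP[_].
by under eq_integral do rewrite /= ger0_norm ?sqr_ge0//.
Qed.

(** Euclidean balls, because [is_fourierL2] truncates to them. *)
Definition ballRn (k : nat) : set V := [set y | enorm y <= k%:R].

Lemma normr_tnth_le_enorm (x : V) i : `|tnth x i| <= enorm x.
Proof.
rewrite -sqrtr_sqr ler_wsqrtr// /dotRn (bigD1 i)//= -expr2 lerDl.
by apply: sumr_ge0 => j _; rewrite -expr2 sqr_ge0.
Qed.

Lemma measurable_enorm : measurable_fun setT (@enorm R n).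
Proof.
have : measurable_fun setT (fun x : V => dotRn x x) by apply: measurable_dotRn; exact: measurable_id.
move=> md; rewrite (_ : @enorm R n = (fun x => dotRn x x `^ 2^-1)).
  exact: (measurableT_comp (measurable_powR _) md).
by apply/funext => x; rewrite powR12_sqrt// /dotRn sumr_ge0// => i _; rewrite -expr2 sqr_ge0.
Qed.

Lemma measurable_ballRn k : measurable (ballRn k).
Proof.
rewrite (_ : ballRn k = (@enorm R n) @^-1` `]-oo, k%:R]); last first.
  by apply/seteqP; split => x /=; rewrite /ballRn in_itv/=.
by rewrite -[X in measurable X]setTI; apply: measurable_enorm => //; exact: measurable_itv.
Qed.

Lemma ballRn_near x : \forall k \near \oo, ballRn k x.
Proof. by near=> k; rewrite /ballRn /=; near: k; exact: nbhs_infty_ger.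
Unshelve. all: by end_near. Qed.

Lemma ballRn_box k : ballRn k `<=` boxRn k%:R.
Proof.
move=> x /= xk i; rewrite /= in_itv/= -ler_norml.
exact: le_trans (normr_tnth_le_enorm x i) xk.
Qed.

(** On a set of finite measure L^2 lies in L^1, here through |f| <= f^2 + 1 on the enclosing box. *)
Lemma L2_ballRn_integrable f k : L2 f ->
  mu.-integrable setT (EFin \o (fun x => f x * \1_(ballRn k) x)).
Proof.
move=> /L2_sqr_lty[mf f2].
have i2 : mu.-integrable setT (EFin \o (fun x => f x ^+ 2)).
  apply/integrableP; split; first by apply/measurable_EFinP; exact: measurable_funX.
  by under eq_integral do rewrite gee0_abs ?lee_fin ?sqr_ge0//.
have ib := integrable_boxn n 1 (ler0n R k).
have := integrableD measurableT i2 ib.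
apply: (@le_Rintegrable _ _ _ mu _ (fun x => f x ^+ 2 + 1 * boxn k%:R x)).
  by apply: measurable_funM => //; apply: measurable_indic; exact: measurable_ballRn.
move=> x; rewrite mul1r /boxn !indicE; have [/set_mem bx|_] := boolP (x \in ballRn k).
  rewrite (mem_set (ballRn_box bx)) mulr1.
  rewrite -[f x ^+ 2](real_normK (num_real _)) -subr_ge0.
  have -> : `|f x| ^+ 2 + 1 - `|f x| = (`|f x| - 2^-1) ^+ 2 + 3 / 4 by field.
  by rewrite addr_ge0 ?sqr_ge0.
by rewrite mulr0 normr0 addr_ge0 ?sqr_ge0.
Qed.

(* On the box of half-width rho the transform F of f is bounded by the L^1 norm
   of f; off it, |F|^2 <= enorm xi |F|^2 / rho. *)
Lemma nash f g rho : Lambda_half f g -> mu.-integrable setT (EFin \o f) -> 0 < rho ->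
  (((2 * pi) ^+ n)%:E * \int[mu]_x (f x ^+ 2)%:E <=
   (16 * (2 * rho) ^+ n * (\int[mu]_x `|f x|) ^+ 2)%:E
   + (8 * (2 * pi) ^+ n / rho)%:E * \int[mu]_x (g x ^+ 2)%:E)%E.
Proof.
move=> [Lf Lg [F [mF1 mF2 cF] [mG1 mG2 cG]]] ifi rho0.
set S := \int[mu]_x `|f x|; pose P : R := (2 * pi) ^+ n.
have P0 : 0 <= P by rewrite exprn_ge0// mulr_ge0// pi_ge0.
pose G xi := Complex (enorm xi `^ (2 * 4^-1)) 0 * F xi.
pose fk k x := f x * \1_(ballRn k) x; pose gk k x := g x * \1_(ballRn k) x.
have [mf f2] := L2_sqr_lty Lf; have [mg g2] := L2_sqr_lty Lg.
have ifk k : mu.-integrable setT (EFin \o fk k) by exact: L2_ballRn_integrable.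
have igk k : mu.-integrable setT (EFin \o gk k) by exact: L2_ballRn_integrable.
have mfk k : measurable_fun setT (fk k) by apply/measurable_EFinP; exact: measurable_int (ifk k).
have mgk k : measurable_fun setT (gk k) by apply/measurable_EFinP; exact: measurable_int (igk k).
have sq0 (h : V -> R) : (0 <= \int[mu]_x (h x ^+ 2)%:E)%E.
  by apply: integral_ge0 => x _; rewrite lee_fin sqr_ge0.
have msqrc (H : V -> R[i]) : measurable_fun setT (fun xi => complex.Re (H xi)) ->
    measurable_fun setT (fun xi => complex.Im (H xi)) ->
    measurable_fun setT (fun xi => (sqrc (H xi))%:E).
  by move=> m1 m2; apply/measurable_EFinP; apply: measurable_funD; exact: measurable_funX.
have mst (h : V -> R) : measurable_fun setT h -> measurable_fun setT (fun xi => (sqrc (fourier h xi))%:E).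
  move=> mh; under eq_fun do rewrite sqrc_fourier.
  by apply/measurable_EFinP; exact: measurable_sqr_transform.
have mfo (h : V -> R) : measurable_fun setT h -> measurable_fun setT (fun xi => complex.Re (fourier h xi))
    /\ measurable_fun setT (fun xi => complex.Im (fourier h xi)).
  move=> mh; have md : measurable_fun setT (fun u : V * V => dotRn u.2 u.1) by exact: measurable_dotRn.
  split; last (apply: measurableT_comp => //).
    apply: (@measurable_Rintegral_snd _ _ _ _ _ mu (fun u : V * V => h u.2 * cos (dotRn u.2 u.1))).
    by apply: measurable_funM; [exact: (measurableT_comp mh)|exact: measurable_cos].
  apply: (@measurable_Rintegral_snd _ _ _ _ _ mu (fun u : V * V => h u.2 * sin (dotRn u.2 u.1))).
  by apply: measurable_funM; [exact: (measurableT_comp mh)|exact: measurable_sin].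
have msub (H : V -> R[i]) (h : V -> R) : measurable_fun setT h ->
    measurable_fun setT (fun xi => complex.Re (H xi)) ->
    measurable_fun setT (fun xi => complex.Im (H xi)) ->
    measurable_fun setT (fun xi => (sqrc (H xi - fourier h xi))%:E).
  move=> mh m1 m2; have [r1 r2] := mfo _ mh; apply: msqrc.
  - rewrite (_ : (fun xi => _) = (fun xi => complex.Re (H xi) - complex.Re (fourier h xi))); last first.
      by apply/funext => xi; case: (H xi) => a b /=.
    exact: measurable_funB.
  - rewrite (_ : (fun xi => _) = (fun xi => complex.Im (H xi) - complex.Im (fourier h xi))); last first.
      by apply/funext => xi; case: (H xi) => a b /=.
    exact: measurable_funB.
have sc0 (z : R[i]) : (0 <= (sqrc z)%:E)%E by rewrite lee_fin sqrc_ge0.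
pose eF k := (\int[mu]_xi (sqrc (F xi - fourier (fk k) xi))%:E)%E.
pose eG k := (\int[mu]_xi (sqrc (G xi - fourier (gk k) xi))%:E)%E.
have cvF : eF @ \oo --> 0%E.
  rewrite (_ : eF = fun k => (\int[mu]_xi (Normc.normc (F xi - fourier (fk k) xi) ^+ 2)%:E)%E).
    exact: cF.
  by apply/funext => k; apply: eq_integral => xi _; rewrite normc_sqr.
have cvG : eG @ \oo --> 0%E.
  rewrite (_ : eG = fun k => (\int[mu]_xi (Normc.normc (G xi - fourier (gk k) xi) ^+ 2)%:E)%E).
    exact: cG.
  by apply/funext => k; apply: eq_integral => xi _; rewrite normc_sqr.
have c2 (c : R) (u : nat -> \bar R) : (u @ \oo --> 0)%E -> (c%:E * u k @[k --> \oo] --> 0)%E.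
  by move=> cu; rewrite -(mule0 c%:E); apply: cvgeZl.
(* [F] and [G] are reached only through transforms of ball truncations. These two comparisons carry
   estimates in either direction, at the price of a factor 2 and of an error that tends to 0. *)
have intle (H : V -> R[i]) (h : V -> R) : measurable_fun setT h ->
    measurable_fun setT (fun xi => complex.Re (H xi)) ->
    measurable_fun setT (fun xi => complex.Im (H xi)) ->
    (\int[mu]_xi (sqrc (H xi))%:E <= 2%:E * \int[mu]_xi (sqrc (fourier h xi))%:E
       + 2%:E * \int[mu]_xi (sqrc (H xi - fourier h xi))%:E)%E /\
    (\int[mu]_xi (sqrc (fourier h xi))%:E <= 2%:E * \int[mu]_xi (sqrc (H xi))%:E
       + 2%:E * \int[mu]_xi (sqrc (H xi - fourier h xi))%:E)%E.
  move=> mh m1 m2; have mH := msqrc _ m1 m2; have ms := msub _ _ mh m1 m2; have mt := mst _ mh.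
  have m2' (u : V -> \bar R) : measurable_fun setT u -> measurable_fun setT (fun x => (2%:E * u x)%E).
    by move=> mu'; exact: measurable_funeM.
  have p2 (z : R[i]) : (0 <= 2%:E * (sqrc z)%:E)%E by rewrite mule_ge0// lee_fin sqrc_ge0.
  split.
  - rewrite -!ge0_integralZl// -ge0_integralD//; [|exact: m2'|exact: m2'].
    apply: ge0_le_integral => //; first by apply: emeasurable_funD; exact: m2'.
    move=> xi _; rewrite -!EFinM -EFinD lee_fin addrC; exact: sqrc_le_sub.
  - rewrite -!ge0_integralZl// -ge0_integralD//; [|exact: m2'|exact: m2'].
    apply: ge0_le_integral => //; first by apply: emeasurable_funD; exact: m2'.
    move=> xi _; rewrite -!EFinM -EFinD lee_fin addrC sqrc_sub; exact: sqrc_le_sub.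
have G_le : (\int[mu]_xi (sqrc (G xi))%:E <= (2 * P)%:E * \int[mu]_x (g x ^+ 2)%:E)%E.
  apply: (lee_addcvg0 (c2 2 _ cvG)) => k.
  have [h _] := intle _ _ (mgk k) mG1 mG2; apply: (le_trans h); rewrite leeD2r//.
  rewrite EFinM -muleA lee_wpmul2l//.
  under eq_integral do rewrite sqrc_fourier.
  apply: (le_trans (plancherel_le (igk k))); rewrite lee_wpmul2l ?lee_fin//.
  rewrite [leRHS](integral_sqr_trunc _ mg (measurable_ballRn k)) leeDl//.
(* The 4 is 2 from [plancherel_ge] times 2 from [intle]; the part of [f] outside the ball joins the
   vanishing error. *)
have F_ge : (P%:E * \int[mu]_x (f x ^+ 2)%:E <= 4%:E * \int[mu]_xi (sqrc (F xi))%:E)%E.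
  have cT := cvg_integral_sqr_trunc mf f2 measurable_ballRn ballRn_near.
  have cTF : (P%:E * \int[mu]_x ((f x - f x * \1_(ballRn k) x) ^+ 2)%:E + 4%:E * eF k @[k --> \oo] --> 0)%E.
    by rewrite -[0%E]adde0; apply: cvgeD => //; exact: c2.
  apply: (lee_addcvg0 cTF) => k.
  rewrite (integral_sqr_trunc _ mf (measurable_ballRn k)) ge0_muleDr// [in leRHS]addeCA.
  rewrite [leLHS]addeC; apply: leeD2l.
  have fk2 : (\int[mu]_x (fk k x ^+ 2)%:E < +oo)%E.
    apply: le_lt_trans f2.
    by rewrite [leRHS](integral_sqr_trunc _ mf (measurable_ballRn k)) leeDl.
  apply: (le_trans (plancherel_ge (ifk k) fk2)).
  have [_ h] := intle _ _ (mfk k) mF1 mF2.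
  have -> : (\int[mu]_xi (sqr_transform (fk k) xi)%:E = \int[mu]_xi (sqrc (fourier (fk k) xi))%:E)%E.
    by apply: eq_integral => xi _; rewrite sqrc_fourier.
  apply: (le_trans (lee_wpmul2l _ h)) => //.
  have i0 (H : V -> R[i]) : (0 <= \int[mu]_xi (sqrc (H xi))%:E)%E by apply: integral_ge0.
  rewrite ge0_muleDr ?mule_ge0// !muleA -!EFinM.
  by rewrite (_ : 2 * 2 = 4 :> R) -?natrM.
have F_le : (\int[mu]_xi (sqrc (F xi))%:E <=
    (4 * (2 * rho) ^+ n * S ^+ 2)%:E + (rho^-1)%:E * \int[mu]_xi (sqrc (G xi))%:E)%E.
  (* The multiplier is |xi|^(1/2), so its square is |xi|. *)
  have GE xi : sqrc (G xi) = enorm xi * sqrc (F xi).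
    rewrite /G sqrc_real_mul; congr (_ * _).
    rewrite -powR_mulrn ?powR_ge0// -powRrM (_ : 2 * 4^-1 * 2 = 1); last by field.
    by rewrite powRr1// /enorm sqrtr_ge0.
  have ri0 : 0 <= rho^-1 by rewrite invr_ge0 ltW.
  (* As an L^2 limit, [F] comes with no pointwise bound; the transform of the truncation does, at
     most 2 S^2 in squared modulus, so the difference is kept as an error. Off the box some
     coordinate exceeds rho, hence so does [enorm xi]. *)
  have pt k xi : sqrc (F xi) <= (4 * S ^+ 2 * boxn rho xi + rho^-1 * sqrc (G xi)) + 2 * sqrc (F xi - fourier (fk k) xi).
    have [xib|xib] := boolP (xi \in boxRn rho).
      rewrite /boxn indicE xib mulr1.
      apply: (le_trans (sqrc_le_sub _ (fourier (fk k) xi))); rewrite addrC lerD2r.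
      have t1 : sqrc (fourier (fk k) xi) <= 2 * S ^+ 2.
        rewrite sqrc_fourier; apply: (le_trans (sqr_transform_le _ (ifk k))).
        rewrite ler_wpM2l// lerXn2r ?nnegrE ?Rintegral_ge0//.
        apply: le_Rintegral => //; [exact: (integrable_norm (ifk k))|exact: (integrable_norm ifi)|].
        by move=> x _; rewrite /fk normrM ler_piMr// indicE; case: (_ \in _); rewrite ?normr1 ?normr0.
      have t2 : 0 <= rho^-1 * sqrc (G xi) by rewrite mulr_ge0// sqrc_ge0.
      lra.
    have [i xii] : exists i, rho < `|tnth xi i|.
      apply: contrapT => /forallNP h; move/negP: xib; apply; apply/mem_set => i /=.
      by rewrite in_itv/= -ler_norml leNgt; apply/negP; exact: h.
    rewrite /boxn indicE (negbTE xib) mulr0 add0r GE mulrA.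
    have t1 : 1 <= rho^-1 * enorm xi.
      rewrite mulrC ler_pdivlMr// mul1r; apply: ltW; apply: (lt_le_trans xii).
      exact: normr_tnth_le_enorm.
    have t2 : 0 <= sqrc (F xi - fourier (fk k) xi) by exact: sqrc_ge0.
    have t3 := ler_wpM2r (sqrc_ge0 (F xi)) t1.
    lra.
  apply: (lee_addcvg0 (c2 2 _ cvF)) => k.
  have ms := msub _ _ (mfk k) mF1 mF2; have mG := msqrc _ mG1 mG2.
  have mb : measurable_fun setT (fun xi : V => (boxn rho xi)%:E).
    by apply/measurable_EFinP; apply: measurable_indic; exact: measurable_boxRn.
  have b0 (xi : V) : (0 <= (boxn rho xi)%:E)%E by rewrite lee_fin boxn_ge0.
  have S40 : (0 <= (4 * S ^+ 2)%:E)%E by rewrite lee_fin mulr_ge0// sqr_ge0.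
  have rE : (0 <= (rho^-1)%:E)%E by rewrite lee_fin.
  have -> : (4 * (2 * rho) ^+ n * S ^+ 2)%:E = ((4 * S ^+ 2)%:E * \int[mu]_x (boxn rho x)%:E)%E.
    by rewrite integral_boxn ?ltW// -EFinM; congr EFin; ring.
  have e1 (xi : V) : (0 <= (4 * S ^+ 2)%:E * (boxn rho xi)%:E)%E by apply: mule_ge0; [exact: S40|exact: b0].
  have e2 xi : (0 <= (rho^-1)%:E * (sqrc (G xi))%:E)%E by apply: mule_ge0; [exact: rE|exact: sc0].
  have e3 xi : (0 <= 2%:E * (sqrc (F xi - fourier (fk k) xi))%:E)%E by rewrite mule_ge0.
  have mm1 : measurable_fun setT (fun xi : V => (4 * S ^+ 2)%:E * (boxn rho xi)%:E)%E by exact: measurable_funeM.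
  have mm2 : measurable_fun setT (fun xi : V => (rho^-1)%:E * (sqrc (G xi))%:E)%E by exact: measurable_funeM.
  have mm3 : measurable_fun setT (fun xi : V => 2%:E * (sqrc (F xi - fourier (fk k) xi))%:E)%E by exact: measurable_funeM.
  rewrite /eF -!ge0_integralZl// -ge0_integralD// -ge0_integralD//; last 2 first.
  - by move=> xi _; exact: adde_ge0.
  - exact: emeasurable_funD.
  apply: ge0_le_integral => //.
  - exact: msqrc.
  - by apply: emeasurable_funD => //; exact: emeasurable_funD.
  - by move=> xi _; rewrite -!EFinM -!EFinD lee_fin.
apply: (le_trans F_ge); apply: (le_trans (lee_wpmul2l _ F_le)) => //.
have gG : (0 <= \int[mu]_xi (sqrc (G xi))%:E)%E by exact: integral_ge0.
rewrite ge0_muleDr//; last 2 first.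
- by rewrite lee_fin mulr_ge0 ?sqr_ge0// mulr_ge0// exprn_ge0// mulr_ge0// ltW.
- by rewrite mule_ge0// lee_fin invr_ge0 ltW.
apply: leeD.
  rewrite -EFinM lee_fin; move: ((2 * rho) ^+ n) (S ^+ 2) => Q Z.
  by have -> : 4 * (4 * Q * Z) = 16 * Q * Z by ring.
rewrite muleA -EFinM; apply: (le_trans (lee_wpmul2l _ G_le)).
  by rewrite lee_fin mulr_ge0// invr_ge0 ltW.
rewrite muleA -EFinM (_ : 4 * rho^-1 * (2 * P) = 8 * (2 * pi) ^+ n / rho)// /P.
by move: ((2 * pi) ^+ n) => Q; ring.
Qed.

End Nash.

(** * De Giorgi iteration *)

Section LowerIntegral.
Context d (T : measurableType d) (R : realType) (m : {measure set T -> \bar R}).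

(* The integral of f is a supremum over the simple functions below it, measurable or not. *)
Lemma ge0_integral_cst_le (D : set T) (f : T -> \bar R) (c : R) : measurable D -> 0 <= c ->
  (forall x, D x -> (c%:E <= f x)%E) -> (c%:E * m D <= \int[m]_(x in D) f x)%E.
Proof.
move=> mD c0 cf; rewrite -integral_cst// integral_mkcond [leRHS]integral_mkcond.
have f0 x : D x -> (0 <= f x)%E by move=> Dx; apply: le_trans (cf _ Dx); rewrite lee_fin.
rewrite !ge0_integralTE; last 2 first.
- by move=> x; rewrite patchE; case: ifPn => // /set_mem; exact: f0.
- by move=> x; rewrite patchE; case: ifPn => // _; rewrite lee_fin.
apply: ereal_sup_le => _ [h hf <-]; exists h => // x; apply: (le_trans (hf x)).
by rewrite !patchE; case: ifPn => // /set_mem; exact: cf.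
Qed.

End LowerIntegral.

Section DeGiorgi.
Context {R : realType} {n : nat}.
Local Notation V := (n.-tuple R).
Local Notation mu := (@lebesgue_Rn R n).
Local Notation leb := (@lebesgue_measure R).
Implicit Types (f g : V -> R).

(** The sum of the two coefficients of [nash] after division by (2 pi)^n, so that a single constant
    multiplies both terms. *)
Definition nash_cst : R := 16 * 2 ^+ n / (2 * pi) ^+ n + 8.

Lemma nash_cst_gt0 : 0 < nash_cst.
Proof.
by rewrite ltr_wpDl// divr_ge0 ?mulr_ge0 ?exprn_ge0// mulr_ge0// pi_ge0.
Qed.

Lemma nash_bound f g rho S G : Lambda_half f g -> mu.-integrable setT (EFin \o f) -> 0 < rho ->
  \int[mu]_x `|f x| <= S -> (\int[mu]_x (g x ^+ 2)%:E <= G%:E)%E -> 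
  (\int[mu]_x (f x ^+ 2)%:E <= (nash_cst * (rho ^+ n * S ^+ 2 + G / rho))%:E)%E.
Proof.
move=> fg fi rho0 fS gG.
have P0 : 0 < (2 * pi) ^+ n :> R by rewrite exprn_gt0// mulr_gt0// pi_gt0.
have := nash fg fi rho0.
have S0 : 0 <= \int[mu]_x `|f x| by exact: Rintegral_ge0.
have G0 : 0 <= G.
  rewrite -lee_fin; apply: le_trans gG; apply: integral_ge0 => x _.
  by rewrite lee_fin sqr_ge0.
move: P0; rewrite /nash_cst; move: ((2 * pi) ^+ n) => P P0 h.
rewrite -(@lee_pmul2l _ P%:E)// ?lte_fin//; apply: (le_trans h).
apply: (@le_trans _ _ ((16 * (2 * rho) ^+ n * S ^+ 2)%:E + (8 * P / rho)%:E * G%:E)%E).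
  apply: leeD.
    have c0 : 0 <= 16 * (2 * rho) ^+ n by rewrite mulr_ge0// exprn_ge0// mulr_ge0// ltW.
    by rewrite lee_fin ler_wpM2l// lerXn2r// nnegrE (le_trans S0).
  by rewrite lee_wpmul2l// lee_fin !mulr_ge0// ?invr_ge0 ltW.
rewrite -!EFinM -EFinD lee_fin exprMn.
have q0 : 0 <= rho ^+ n * S ^+ 2 by rewrite mulr_ge0 ?sqr_ge0// exprn_ge0// ltW.
have g0 : 0 <= G / rho by rewrite divr_ge0// ltW.
have -> : P * ((16 * 2 ^+ n / P + 8) * (rho ^+ n * S ^+ 2 + G / rho))
  = (16 * 2 ^+ n + 8 * P) * (rho ^+ n * S ^+ 2 + G / rho).
  by move: (rho ^+ n * S ^+ 2 + G / rho) => Z; field; rewrite gt_eqF.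
have -> : 16 * (2 ^+ n * rho ^+ n) * S ^+ 2 + 8 * P / rho * G
  = 16 * 2 ^+ n * (rho ^+ n * S ^+ 2) + 8 * P * (G / rho) by ring.
move: q0 g0; move: (rho ^+ n * S ^+ 2) (G / rho) => Q Z Q0 Z0.
have t1 : 0 <= 8 * P * Q by rewrite !mulr_ge0// ltW.
have t2 : 0 <= 16 * 2 ^+ n * Z by rewrite !mulr_ge0// exprn_ge0.
by move: t1 t2; rewrite mulrDl !mulrDr; lra.
Qed.

(** * Truncation at a level *)

Section truncation.
Implicit Types lam : R.

Lemma trunc_ge0 lam f x : 0 <= trunc lam f x.
Proof. by rewrite /trunc le_max lexx orbT. Qed.

Lemma measurable_trunc lam f : measurable_fun setT f -> measurable_fun setT (trunc lam f).
Proof.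
by move=> mf; apply: measurable_maxr; [exact: measurable_funB|exact: measurable_cst].
Qed.

Lemma trunc_le lam lam' f x : lam <= lam' -> trunc lam' f x <= trunc lam f x.
Proof.
move=> ll; rewrite /trunc ge_max le_max lerD2l lerN2 ll/=.
by rewrite le_max lexx orbT.
Qed.

(** Where f > lam' one has f - lam >= lam' - lam and f - lam >= f - lam'; the product of the two is
    the claim. This pointwise form of Chebyshev puts the higher truncation in L^1 as soon as the
    lower one is in L^2. *)
Lemma trunc_le_sqr lam lam' f x : lam < lam' ->
  trunc lam' f x <= (lam' - lam)^-1 * trunc lam f x ^+ 2.
Proof.
move=> ll; have d0 : 0 < lam' - lam by rewrite subr_gt0.
rewrite /trunc; have [fl|lf] := leP (f x - lam') 0.
  by rewrite mulr_ge0 ?sqr_ge0// invr_ge0 ltW.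
rewrite -ler_pdivrMl ?invr_gt0// invrK (max_idPl _); last by lra.
rewrite expr2; apply: ler_pM; lra.
Qed.

Lemma integral_trunc_le lam lam' f : measurable_fun setT f -> lam <= lam' ->
  (\int[mu]_x (trunc lam' f x ^+ 2)%:E <= \int[mu]_x (trunc lam f x ^+ 2)%:E)%E.
Proof.
move=> mf ll; apply: ge0_le_integral => //.
- by move=> x _; rewrite lee_fin sqr_ge0.
- by apply/measurable_EFinP; apply: measurable_funX; exact: measurable_trunc.
- by apply/measurable_EFinP; apply: measurable_funX; exact: measurable_trunc.
- move=> x _; rewrite lee_fin lerXn2r ?nnegrE ?trunc_ge0//; exact: trunc_le.
Qed.

End truncation.

Lemma Lambda_half_energy_ge0 f : (0 <= Lambda_half_energy f)%E.
Proof.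
apply: le_ereal_inf_tmp => _ [g _ <-]; apply: integral_ge0 => x _.
by rewrite lee_fin sqr_ge0.
Qed.

(** * The iteration in level and time *)

Section iteration.
Variables (T : R) (theta : R -> V -> R).
Hypotheses (T0 : 0 < T)
  (mtheta : forall t, 0 <= t <= T -> measurable_fun setT (theta t))
  (energy : level_set_energy_inequality T theta).

Let e lam t : \bar R := (\int[mu]_x (trunc lam (theta t) x ^+ 2)%:E)%E.

Lemma energy_nonincreasing lam s t : 0 < lam -> 0 <= s -> s <= t -> t <= T -> (e lam t <= e lam s)%E.
Proof.
move=> lam0 s0; rewrite le_eqVlt => /predU1P[->//|st] tT.
apply: le_trans (energy lam0 s0 st tT); rewrite leeDl// mule_ge0//.
by apply: integral_ge0 => x _; exact: Lambda_half_energy_ge0.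
Qed.

Lemma de_giorgi_step lam lam' s t A rho : 0 < lam -> lam < lam' -> 0 <= s -> s < t -> t <= T ->
  0 < A -> 0 < rho -> (e lam s <= A%:E)%E ->
  (e lam' t <= (nash_cst * (rho ^+ n * (A / (lam' - lam)) ^+ 2 + A / (t - s) / rho))%:E)%E.
Proof.
move=> lam0 ll s0 st tT A0 rho0 eA.
have lam'0 : 0 < lam' by exact: lt_trans ll.
have ts0 : 0 < t - s by rewrite subr_gt0.
have mth u : s <= u -> u <= t -> measurable_fun setT (theta u).
  by move=> su ut; apply: mtheta; rewrite (le_trans s0 su) (le_trans ut tT).
have e'A : (e lam' s <= A%:E)%E.
  by apply: le_trans eA; apply: integral_trunc_le; [apply: mth => //; exact: ltW|exact: ltW].
(* If the dissipation were at least A / (t - s) throughout [s, t], its integral would be at least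
   [A], and the factor 2 of the energy inequality would give 2 A <= A. Measurability of the
   dissipation in time is not established, hence the recourse to [ge0_integral_cst_le]. *)
have [tau [stau taut Dtau]] : exists tau, [/\ s <= tau, tau <= t &
    (Lambda_half_energy (trunc lam' (theta tau)) < (A / (t - s))%:E)%E].
  apply: contrapT => nD.
  have DA tau : `[s, t]%classic tau -> ((A / (t - s))%:E <= Lambda_half_energy (trunc lam' (theta tau)))%E.
    rewrite /= in_itv/= => /andP[stau taut]; rewrite leNgt; apply/negP => lt.
    by apply: nD; exists tau.
  have As0 : 0 <= A / (t - s) by rewrite divr_ge0 ?ltW.
  have lm : leb `[s, t]%classic = (t - s)%:E by rewrite lebesgue_measure_itv/= lte_fin st -EFinB.
  have AD : (A%:E <= \int[leb]_(u in `[s, t]) Lambda_half_energy (trunc lam' (theta u)))%E.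
    have -> : (A%:E = (A / (t - s))%:E * leb `[s, t]%classic)%E.
      by rewrite lm -EFinM divfK// gt_eqF.
    exact: ge0_integral_cst_le.
  have := energy lam'0 s0 st tT => /le_trans/(_ e'A).
  apply/negP; rewrite -ltNge.
  apply: (@lt_le_trans _ _ (2%:E * A%:E)%E); first by rewrite -EFinM lte_fin; lra.
  apply: (le_trans (lee_wpmul2l _ AD)) => //; rewrite leeDr//.
  by apply: integral_ge0 => x _; rewrite lee_fin sqr_ge0.
(* An infimum below a real number is taken over a nonempty set: this [g] shows that the truncation
   at time [tau] lies in the domain of Lambda^(1/2). *)
have [_ [g fg <-] gA] : exists2 y, [set \int[mu]_x (g x ^+ 2)%:E | g in Lambda_half (trunc lam' (theta tau))]%E y & (y < (A / (t - s))%:E)%E.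
  by apply/ereal_inf_ltP.
have mtau := mth _ stau taut.
have elA : (e lam tau <= A%:E)%E.
  by apply: le_trans eA; apply: energy_nonincreasing => //; exact: le_trans tT.
have isq : mu.-integrable setT (EFin \o (fun x => trunc lam (theta tau) x ^+ 2)).
  apply/integrableP; split.
    by apply/measurable_EFinP; apply: measurable_funX; exact: measurable_trunc.
  under eq_integral do rewrite /= ger0_norm ?sqr_ge0//.
  by apply: le_lt_trans elA _; rewrite ltry.
have iq := integrableZl measurableT (lam' - lam)^-1 isq.
have tn x : `|trunc lam' (theta tau) x| <= (lam' - lam)^-1 * trunc lam (theta tau) x ^+ 2.
  by rewrite ger0_norm ?trunc_ge0//; exact: trunc_le_sqr.
have mt' : measurable_fun setT (trunc lam' (theta tau)) by exact: measurable_trunc.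
have it : mu.-integrable setT (EFin \o trunc lam' (theta tau)).
  exact: (@le_Rintegrable _ _ _ mu _ _ mt' tn iq).
apply: (@le_trans _ _ (e lam' tau)).
  by apply: energy_nonincreasing => //; exact: le_trans stau.
apply: (nash_bound fg it rho0); last exact: ltW.
have d0 : 0 < lam' - lam by rewrite subr_gt0.
apply: (@le_trans _ _ (\int[mu]_x ((lam' - lam)^-1 * trunc lam (theta tau) x ^+ 2))).
  by apply: le_Rintegral => //; exact: (integrable_norm it).
rewrite RintegralZl// mulrC ler_pM2r ?invr_gt0//.
by rewrite -lee_fin -Rintegral_EFin.
Qed.

(** With rho proportional to 2^k and level gaps proportional to 2^(-k), the quadratic term of the
    recursion is a multiple of 2^(k (n + 2)) a_k^2. At this rate one factor a_k exactly absorbs the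
    growing power of 2. *)
Definition decay : R := (2 ^+ n.+2)^-1.
(** Chosen so that the quadratic term is exactly decay / 2 times a_k when M^2 = [de_giorgi_cst] A /
    T^n. The last factor comes from rho^n, and 32 is 2 times the 16 from the squared level gap M /
    2^(k + 2). *)
Definition de_giorgi_cst : R := 32 * nash_cst / decay * (4 * nash_cst / decay) ^+ n.

Lemma decay_gt0 : 0 < decay. Proof. by rewrite invr_gt0 exprn_gt0. Qed.

Lemma de_giorgi_cst_gt0 : 0 < de_giorgi_cst.
Proof.
have := nash_cst_gt0; have := decay_gt0 => d0 k0.
by rewrite /de_giorgi_cst mulr_gt0 ?exprn_gt0 ?divr_gt0// ?mulr_gt0.
Qed.

(** The exponent k + 1 starts the levels at M / 2: the energy inequality is available at positive
    levels only. *)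
Let level M k : R := M * (1 - (2 ^+ k.+1)^-1).
Let time k : R := T * (1 - (2 ^+ k)^-1).

Let pow2_gt0 k : 0 < 2 ^+ k :> R. Proof. by rewrite exprn_gt0. Qed.

Let pow2V_le1 k : (2 ^+ k)^-1 <= 1 :> R.
Proof. by rewrite invf_le1// exprn_ege1// ler1n. Qed.

Lemma de_giorgi_iteration M A k : 0 < M -> 0 < A ->
  de_giorgi_cst * A / T ^+ n <= M ^+ 2 ->
  (e (level M 0) 0 <= A%:E)%E ->
  (e (level M k) (time k) <= (A * decay ^+ k)%:E)%E.
Proof.
move=> M0 A0 MA e0; elim: k => [|k IH].
  by rewrite /time expr0 invr1 subrr mulr0 expr0 mulr1.
have K0 := nash_cst_gt0; have d0 := decay_gt0.
have dk0 : 0 < decay ^+ k by rewrite exprn_gt0.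
have Ak0 : 0 < A * decay ^+ k by rewrite mulr_gt0.
(* Makes the dissipation term equal to decay / 2 times a_k, half of what the next step may cost; the
   quadratic term gets the other half. *)
pose rho := 4 * nash_cst * 2 ^+ k / (decay * T).
have rho0 : 0 < rho by rewrite divr_gt0 ?mulr_gt0.
have lev0 : 0 < level M k.
  rewrite mulr_gt0// subr_gt0 invf_lt1// exprn_egt1// ltr1n//.
have levS : level M k.+1 - level M k = M / 2 ^+ k.+2.
  rewrite /level !exprSr; have := pow2_gt0 k; move: (2 ^+ k) => Z Z0; by field; rewrite gt_eqF.
have timeS : time k.+1 - time k = T / 2 ^+ k.+1.
  rewrite /time !exprSr; have := pow2_gt0 k; move: (2 ^+ k) => Z Z0; by field; rewrite gt_eqF.
have lt1 : level M k < level M k.+1 by rewrite -subr_gt0 levS divr_gt0.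
have lt2 : time k < time k.+1 by rewrite -subr_gt0 timeS divr_gt0.
have t0 : 0 <= time k by rewrite mulr_ge0 ?(ltW T0)// subr_ge0.
have tT : time k.+1 <= T by rewrite ler_piMr ?(ltW T0)// gerBl invr_ge0 exprn_ge0.
apply: (le_trans (de_giorgi_step lev0 lt1 t0 lt2 tT Ak0 rho0 IH)).
rewrite lee_fin levS timeS.
have second : nash_cst * (A * decay ^+ k / (T / 2 ^+ k.+1) / rho) = decay / 2 * (A * decay ^+ k).
  rewrite /rho exprSr; have := pow2_gt0 k; have := d0; have := K0; move: (decay ^+ k) (2 ^+ k).
  move: nash_cst decay => K dd D Z KK dd0 Z0; field.
  by rewrite !gt_eqF.
have first : nash_cst * (rho ^+ n * (A * decay ^+ k / (M / 2 ^+ k.+2)) ^+ 2) <= decay / 2 * (A * decay ^+ k).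
  have dE : decay ^+ k * (2 ^+ k) ^+ n * (2 ^+ k) ^+ 2 = 1.
    rewrite -mulrA -exprD addn2 -exprM mulnC exprM -exprMn /decay mulVf ?expr1n//.
  (* The quadratic term is its share of the budget times two ratios, the first at most 1 by the
     choice of [M], the second equal to 1 by [dE]. *)
  have -> : nash_cst * (rho ^+ n * (A * decay ^+ k / (M / 2 ^+ k.+2)) ^+ 2)
     = decay / 2 * (A * decay ^+ k) * (de_giorgi_cst * A / T ^+ n / M ^+ 2) * (decay ^+ k * (2 ^+ k) ^+ n * (2 ^+ k) ^+ 2).
    have E (a b c : R) : (a * b / c) ^+ n = a ^+ n * b ^+ n / c ^+ n.
      by rewrite exprMn [X in X * _]exprMn exprVn.
    rewrite /rho /de_giorgi_cst (exprSr 2 k.+1) (exprSr 2 k).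
    have -> : 4 * nash_cst * 2 ^+ k / (decay * T) = (4 * nash_cst / decay) * 2 ^+ k / T.
      by rewrite invfM; ring.
    rewrite E.
    have := exprn_gt0 n T0; have := pow2_gt0 k; have := d0.
    move: (2 ^+ k) ((2 ^+ k) ^+ n) (T ^+ n) (decay ^+ k) ((4 * nash_cst / decay) ^+ n).
    move: nash_cst decay => K dd Z W Tn D Q dd0 Z0 Tn0.
    by field; rewrite !gt_eqF.
  rewrite dE mulr1 ler_piMr//.
    by rewrite mulr_ge0// ?ltW// divr_gt0.
  by rewrite ler_pdivrMr ?exprn_gt0// mul1r.
rewrite mulrDr second (exprS decay k).
apply: (le_trans (lerD first (lexx _))).
by rewrite -mulrDl -splitr mulrCA.
Qed.

Lemma de_giorgi_ae_le M A : 0 < M -> 0 < A ->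
  de_giorgi_cst * A / T ^+ n <= M ^+ 2 ->
  (\int[mu]_x (theta 0 x ^+ 2)%:E <= A%:E)%E ->
  {ae mu, forall x, theta T x <= M}.
Proof.
move=> M0 A0 MA th0.
have m0 : measurable_fun setT (theta 0) by apply: mtheta; rewrite lexx ltW.
have mT : measurable_fun setT (theta T) by apply: mtheta; rewrite lexx ltW.
have e0 : (e (level M 0) 0 <= A%:E)%E.
  apply: le_trans th0; apply: ge0_le_integral => //.
  - by move=> x _; rewrite lee_fin sqr_ge0.
  - by apply/measurable_EFinP; apply: measurable_funX; exact: measurable_trunc.
  - by apply/measurable_EFinP; exact: measurable_funX.
  - move=> x _; rewrite lee_fin -[leRHS](real_normK (num_real _)).
    rewrite lerXn2r ?nnegrE ?trunc_ge0// /trunc ge_max normr_ge0 andbT.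
    apply: le_trans (ler_norm _); rewrite gerBl /level mulr_ge0 ?ltW// subr_gt0.
    by rewrite invf_lt1// exprn_egt1// ltr1n.
have lev0 k : 0 < level M k.
  by rewrite mulr_gt0// subr_gt0 invf_lt1// exprn_egt1// ltr1n.
(* Every level lies below [M] and every time before [T], so each iterate dominates the energy at
   level [M] and time [T]. *)
have eT k : (e M T <= (A * decay ^+ k)%:E)%E.
  apply: le_trans (de_giorgi_iteration k M0 A0 MA e0).
  apply: (@le_trans _ _ (e (level M k) T)).
    by apply: integral_trunc_le => //; rewrite ler_piMr ?(ltW M0)// gerBl invr_ge0 exprn_ge0.
  apply: energy_nonincreasing => //.
    by rewrite mulr_ge0 ?(ltW T0)// subr_ge0.
  by rewrite ler_piMr ?(ltW T0)// gerBl invr_ge0 exprn_ge0.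
have eT0 : (e M T <= 0)%E.
  have c : ((A * decay ^+ k)%:E @[k --> \oo] --> (A * 0)%:E)%E.
    apply: cvg_EFin; first exact: nearW.
    apply: cvgM; first exact: cvg_cst.
    apply: cvg_expr; rewrite ger0_norm ?ltW ?decay_gt0// /decay.
    by rewrite invf_lt1// exprn_egt1// ltr1n.
  rewrite mulr0 in c.
  by apply: (cvge_to_ge c); exact: nearW.
have mtr : measurable_fun setT (fun x => (trunc M (theta T) x ^+ 2)%:E).
  by apply/measurable_EFinP; apply: measurable_funX; exact: measurable_trunc.
have : (\int[mu]_x `|(trunc M (theta T) x ^+ 2)%:E| = 0)%E.
  under eq_integral do rewrite gee0_abs ?lee_fin ?sqr_ge0//.
  by apply/eqP; rewrite eq_le eT0/=; apply: integral_ge0 => x _; rewrite lee_fin sqr_ge0.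
move/(ae_eq_integral_abs mu measurableT mtr); apply: filterS => x /(_ I)/=.
case=> /eqP; rewrite sqrf_eq0 /trunc => /eqP h.
by rewrite -subr_le0 -h le_max lexx.
Qed.

End iteration.
End DeGiorgi.

(** * From the one-sided bounds to the essential supremum *)

Lemma L2norm_sqr (R : realType) (n : nat) (f : n.-tuple R -> R) : L2 f ->
  (\int[lebesgue_Rn n]_x (f x ^+ 2)%:E = (fine (L2norm f) ^+ 2)%:E)%E.
Proof.
move=> Lf; have [mf f2] := L2_sqr_lty Lf.
have h : ((L2norm f) `^ 2 = \int[lebesgue_Rn n]_x (f x ^+ 2)%:E)%E.
  rewrite /L2norm poweR_Lnorm ?pnatr_eq0//; apply: eq_integral => x _.
  by rewrite /= powR_mulrn// real_normK// num_real.
have n0 : (0 <= L2norm f)%E by exact: Lnorm_ge0.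
have fin : L2norm f \is a fin_num.
  rewrite ge0_fin_numE//; apply: (@lty_poweRy _ _ 2); first by rewrite pnatr_eq0.
  by rewrite h.
by rewrite -h -{1}(fineK fin) poweR_EFin powR_mulrn// fine_ge0.
Qed.

Theorem theorem1 (R : realType) (N : nat) (hN : (1 <= N)%N) :
  exists C : R, 0 < C /\
    forall (T : R) (theta : R -> N.-tuple R -> R),
      0 < T ->
      (forall t : R, 0 <= t <= T -> measurable_fun setT (theta t)) ->
      bochner_Lp L2 L2norm +oo%E T theta ->
      bochner_Lp H12 H12norm 2%:E T theta ->
      L2 (theta 0) ->
      level_set_energy_inequality T theta ->
      level_set_energy_inequality T (fun t x => - theta t x) ->
      (ess_sup (lebesgue_Rn N) (fun x => `|theta T x|%:E)
       <= (C * (fine (L2norm (theta 0)) / T `^ (N%:R / 2)))%:E)%E.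
Proof.
have K0 := @de_giorgi_cst_gt0 R N; set K := @de_giorgi_cst R N in K0.
(* The iteration asks for M^2 >= K A / T^N with A close to the squared norm of theta_0; the square
   root turns this into a value of [M]. *)
exists (Num.sqrt K); split=> [|T theta T0 mth _ _ L0 energy energyN]; first by rewrite sqrtr_gt0.
set n0 := fine (L2norm (theta 0)).
have n00 : 0 <= n0 by rewrite fine_ge0// Lnorm_ge0.
pose Q := T `^ (N%:R / 2).
have Q0 : 0 < Q by exact: powR_gt0.
have Q2 : Q ^+ 2 = T ^+ N.
  by rewrite -powR_mulrn ?powR_ge0// /Q -powRrM divfK ?pnatr_eq0// powR_mulrn// ltW.
have s0 : 0 < Num.sqrt K by rewrite sqrtr_gt0.
have th0 := L2norm_sqr L0.
apply/lee_addgt0Pr => d d0.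
(* The iteration needs [A] and [M] positive, whereas the norm of theta_0 may be 0. The slack [eta]
   is fitted so that [M] exceeds the claimed bound by exactly [d]. *)
pose eta := d * Q / Num.sqrt K.
have eta0 : 0 < eta by rewrite divr_gt0 ?mulr_gt0.
have ne0 : 0 < n0 + eta by rewrite ltr_wpDl.
pose M := Num.sqrt K * ((n0 + eta) / Q).
have M0 : 0 < M by rewrite mulr_gt0 ?divr_gt0.
have -> : ((Num.sqrt K * (n0 / T `^ (N%:R / 2)))%:E + d%:E = M%:E)%E.
  by rewrite -EFinD -/Q /M /eta; congr EFin; field; rewrite !gt_eqF.
have A0 : 0 < (n0 + eta) ^+ 2 by rewrite exprn_gt0.
have MA : K * (n0 + eta) ^+ 2 / T ^+ N <= M ^+ 2.
  have -> : M ^+ 2 = Num.sqrt K ^+ 2 * (n0 + eta) ^+ 2 / Q ^+ 2 by rewrite /M; field; rewrite gt_eqF.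
  by rewrite -Q2 sqr_sqrtr ?(ltW K0).
have nA : ((n0 ^+ 2)%:E <= ((n0 + eta) ^+ 2)%:E)%E.
  by rewrite lee_fin lerXn2r ?nnegrE ?(ltW ne0)// lerDl ltW.
have up := de_giorgi_ae_le T0 mth energy M0 A0 MA.
have mthN t : 0 <= t <= T -> measurable_fun setT (fun x => - theta t x).
  by move=> /mth mt; exact: measurableT_comp.
have dn := de_giorgi_ae_le T0 mthN energyN M0 A0 MA.
apply/ess_supP.
have {}up : {ae lebesgue_Rn N, forall x, theta T x <= M} by apply: up; rewrite th0.
have {}dn : {ae lebesgue_Rn N, forall x, - theta T x <= M}.
  by apply: dn; under eq_integral do rewrite sqrrN; rewrite th0.
apply: filterS2 up dn => x h1 h2.
by rewrite lee_fin ler_norml h1 andbT lerNl.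
Qed.
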